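(* There is a nondeterministic algorithm which, given a $\mathrm{PINC}$-formula $\varphi$ all of whose inclusion atoms have arity at most $k$, runs in time $O(2^k\cdot p(|\varphi|))$ for some polynomial $p$, has an accepting run if and only if $\varphi$ is satisfiable, and on accepting runs outputs a team $T$ with $T\models\varphi$. In particular, the satisfiability problem for $\mathrm{PINC}$ parameterised by $\mathrm{arity}$ is in $\mathrm{paraNP}$.
   Context: An assignment maps propositional variables to $\{0,1\}$; a team is a finite set of assignments over a common finite set of variables; $s(\mathbf x)=(s(x_1),\dots,s(x_n))$. $\mathrm{PINC}$-formulas: $\varphi ::= \top\mid\bot\mid x\mid\neg x\mid \mathbf x\subseteq\mathbf y\mid\varphi\land\varphi\mid\varphi\lor\varphi$, with $|\mathbf x|=|\mathbf y|$. Semantics (lax): $T\models\top$ always; $T\models\bot$ iff $T=\emptyset$; $T\models x$ (resp. $\neg x$) iff every $t\in T$ has $t(x)=1$ (resp. $0$); $T\models\varphi\land\psi$ iff both hold on $T$; $T\models\varphi\lor\psi$ iff there are $T_1,T_2$ with $T_1\cup T_2=T$, $T_1\models\varphi$, $T_2\models\psi$; $T\models\mathbf x\subseteq\mathbf y$ iff for every $t\in T$ there is $t'\in T$ with $t(\mathbf x)=t'(\mathbf y)$. The arity of $\mathbf x\subseteq\mathbf y$ is $|\mathbf x|$; $\mathrm{arity}$ of $\varphi$ is the maximum arity of its inclusion atoms. $\varphi$ is satisfiable if some non-empty team satisfies it. A parameterised problem is in $\mathrm{paraNP}$ if decidable nondeterministically in time $f(k)\cdot p(|x|)$, $f$ computable,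 $p$ polynomial. *)

(* Defs.v *)
From mathcomp Require Import all_boot ssralg poly finmap.
From mathcomp Require Import boolp.

Set Implicit Arguments.
Unset Strict Implicit.
Unset Printing Implicit Defensive.

(** * Propositional inclusion logic *)

Inductive formula : Type :=
| PTop
| PBot
| PPos of nat
| PNeg of nat
| PInc n of n.-tuple nat & n.-tuple nat
| PAnd of formula & formula
| POr of formula & formula.

Fixpoint vars (phi : formula) : {fset nat} :=
  match phi with
  | PTop | PBot => fset0
  | PPos x | PNeg x => [fset x]%fset
  | PInc _ xs ys => ([fset x in val xs] `|` [fset y in val ys])%fset
  | PAnd phi psi | POr phi psi => (vars phi `|` vars psi)%fset
  end.

Fixpoint arity (phi : formula) : nat :=
  match phi with
  | PInc n _ _ => n
  | PAnd phi psi | POr phi psi => maxn (arity phi) (arity psi)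
  | _ => 0
  end.

Definition assignment := {fmap nat -> bool}.

Definition team_over (V : {fset nat}) (T : {fset assignment}) : Prop :=
  forall t, t \in T -> domf t = V.

(* [t.[? x]] is [Some (t x)] on the domain of [t] and [None] outside it; [sat]
   is only ever used on teams whose domain contains the variables of [phi]. *)
Definition values (t : assignment) (xs : seq nat) : seq (option bool) :=
  [seq t.[? x]%fmap | x <- xs].

Fixpoint sat (T : {fset assignment}) (phi : formula) : Prop :=
  match phi with
  | PTop => True
  | PBot => T = fset0
  | PPos x => forall t, t \in T -> t.[? x]%fmap = Some true
  | PNeg x => forall t, t \in T -> t.[? x]%fmap = Some false
  | PInc _ xs ys =>
      forall t, t \in T -> exists2 t', t' \in T & values t xs = values t' ys
  | PAnd phi psi => sat T phi /\ sat T psi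
  | POr phi psi =>
      exists T1 T2, [/\ (T1 `|` T2)%fset = T, sat T1 phi & sat T2 psi]
  end.

(* [T] is a non-empty team, on a domain containing the variables of [phi],
   that satisfies [phi]. *)
Definition witness (phi : formula) (T : {fset assignment}) : Prop :=
  exists V, [/\ (vars phi `<=` V)%fset, team_over V T, T <> fset0 & sat T phi].

Definition satisfiable (phi : formula) : Prop := exists T, witness phi T.

(** * Words *)

Inductive symbol : Type :=
  STop | SBot | SPos | SNeg | SInc | SSub | SAnd | SOr | SEnd | SHash
| SBit of bool.

Definition word := seq symbol.

(* Binary digits, least significant first, without leading zeros. *)
Fixpoint pos_bits (p : BinNums.positive) : seq bool :=
  match p with
  | BinNums.xH => [:: true]
  | BinNums.xO p => false :: pos_bits p
  | BinNums.xI p => true :: pos_bits p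
  end.

Definition nat_bits (n : nat) : seq bool :=
  match bin_of_nat n with BinNums.N0 => [::] | BinNums.Npos p => pos_bits p end.

Definition enc_var (x : nat) : word := rcons (map SBit (nat_bits x)) SHash.

Definition enc_vars (xs : seq nat) : word := flatten (map enc_var xs).

(* Polish notation; the size of [phi] is the length of [enc phi]. *)
Fixpoint enc (phi : formula) : word :=
  match phi with
  | PTop => [:: STop]
  | PBot => [:: SBot]
  | PPos x => SPos :: enc_var x
  | PNeg x => SNeg :: enc_var x
  | PInc _ xs ys => SInc :: enc_vars xs ++ SSub :: enc_vars ys ++ [:: SEnd]
  | PAnd phi psi => SAnd :: enc phi ++ enc psi
  | POr phi psi => SOr :: enc phi ++ enc psi
  end.

(* An assignment is written as the list of the literals it makes true, and a
   team as the concatenation of its assignments; order and repetitions are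
   irrelevant. *)
Definition enc_lit (l : nat * bool) : word :=
  (if l.2 then SPos else SNeg) :: enc_var l.1.

Definition enc_assignment (s : seq (nat * bool)) : word :=
  rcons (flatten (map enc_lit s)) SEnd.

Definition enc_team (S : seq (seq (nat * bool))) : word :=
  flatten (map enc_assignment S).

Definition lists_assignment (s : seq (nat * bool)) (t : assignment) : Prop :=
  forall x b, (x, b) \in s <-> t.[? x]%fmap = Some b.

Definition encodes_team (w : word) (T : {fset assignment}) : Prop :=
  exists S, [/\ w = enc_team S,
    forall s, s \in S -> exists2 t, t \in T & lists_assignment s t &
    forall t, t \in T -> exists2 s, s \in S & lists_assignment s t].

(** * Nondeterministic random access machines *)

(* The random access machines of Cook and Reckhow (Time bounded random access
   machines, 1973), extended by an instruction that guesses one bit.  Every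
   instruction takes one unit of time; as there is no multiplication, registers
   grow by at most one bit per step, and so the uniform cost measure is
   polynomially related to the running time of Turing machines. *)
Inductive instr : Type :=
| IConst of nat & nat          (* R_i := c *)
| IAdd of nat & nat & nat      (* R_i := R_j + R_k *)
| ISub of nat & nat & nat      (* R_i := R_j - R_k, truncated at 0 *)
| ILoad of nat & nat           (* R_i := R_(R_j) *)
| IStore of nat & nat          (* R_(R_i) := R_j *)
| IJumpPos of nat & nat        (* if R_i > 0 then go to instruction l *)
| IRead of nat                 (* R_i := next input item, 0 when exhausted *)
| IPrint of nat                (* append R_i to the output *)
| IGuess of nat                (* R_i := 0 or 1, nondeterministically *)
| IAccept.

Definition program := seq instr.

Record config := Config {
  pc : nat;
  reg : nat -> nat;
  input : seq nat;
  output : seq nat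
}.

Definition upd (m : nat -> nat) (i v : nat) : nat -> nat :=
  fun j => if j == i then v else m j.

Definition init (w : seq nat) : config := Config 0 (fun _ => 0) w [::].

(* The bit [b] resolves the nondeterminism of [IGuess].  A machine whose program
   counter leaves the program halts without accepting. *)
Definition step (P : program) (b : bool) (c : config) : option config :=
  let: Config l m u o := c in
  match onth P l with
  | Some (IConst i v) => Some (Config l.+1 (upd m i v) u o)
  | Some (IAdd i j k) => Some (Config l.+1 (upd m i (m j + m k)%N) u o)
  | Some (ISub i j k) => Some (Config l.+1 (upd m i (m j - m k)%N) u o)
  | Some (ILoad i j) => Some (Config l.+1 (upd m i (m (m j))) u o)
  | Some (IStore i j) => Some (Config l.+1 (upd m (m i) (m j)) u o)
  | Some (IJumpPos i l') =>
      Some (Config (if (0 < m i)%N then l' else l.+1) m u o)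
  | Some (IRead i) =>
      Some (Config l.+1 (upd m i (head 0 u)) (behead u) o)
  | Some (IPrint i) => Some (Config l.+1 m u (rcons o (m i)))
  | Some (IGuess i) => Some (Config l.+1 (upd m i (nat_of_bool b)) u o)
  | Some IAccept | None => None
  end.

Fixpoint reaches (P : program) (t : nat) (c c' : config) : Prop :=
  match t with
  | 0 => c = c'
  | t.+1 => exists b c1, step P b c = Some c1 /\ reaches P t c1 c'
  end.

Definition accepting (P : program) (c : config) : Prop :=
  onth P (pc c) = Some IAccept.

(* [P] has an accepting run on input [w] with output [o]. *)
Definition accepts (P : program) (w o : seq nat) : Prop :=
  exists t c, [/\ reaches P t (init w) c, accepting P c & output c = o].

(* All runs of [P] on [w], accepting or not, halt within [t] steps. *)
Definition runs_within (P : program) (w : seq nat) (t : nat) : Prop :=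
  forall n c, reaches P n (init w) c -> (n <= t)%N.

Definition guess_free (P : program) : bool :=
  all (fun i => if i is IGuess _ then false else true) P.

Definition computable (f : nat -> nat) : Prop :=
  exists2 P, guess_free P & forall n, accepts P [:: n] [:: f n].

(* Symbols are presented to the machine as the numbers 1 to 12; 0 is reserved
   for the end of the input. *)
Definition code (a : symbol) : nat :=
  match a with
  | STop => 1 | SBot => 2 | SPos => 3 | SNeg => 4 | SInc => 5 | SSub => 6
  | SAnd => 7 | SOr => 8 | SEnd => 9 | SHash => 10
  | SBit b => if b then 12 else 11
  end.

Definition codes (w : word) : seq nat := map code w.

(** * Parameterised problems *)

Definition paraNP (Q : word -> Prop) (kappa : word -> nat) : Prop :=
  exists (P : program) (f : nat -> nat) (p : {poly nat}),
    [/\ computable f,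
        forall w, runs_within P (codes w) (f (kappa w) * (p.[size w])%R)%N &
        forall w, (exists o, accepts P (codes w) o) <-> Q w].

Definition pinc_sat (w : word) : Prop :=
  exists2 phi, enc phi = w & satisfiable phi.

(* The arity of the formula encoded by [w] (unique by [enc_inj]), and 0 if
   there is none. *)
Definition pinc_arity (w : word) : nat :=
  if pselect (exists phi, enc phi = w) is left e then arity (sval (cid e))
  else 0.

Lemma pos_bits_inj : injective pos_bits.
Proof.
have ne p : pos_bits p <> [::] by case: p.
elim=> [p IH|p IH|] [q|q|] //= []; last by move/esym/ne.
- by move/IH->.
- by move/ne.
- by move/IH->.
Qed.

Lemma nat_bits_inj : injective nat_bits.
Proof.
move=> m n; rewrite /nat_bits => e; apply: (can_inj bin_of_natK).
case: (bin_of_nat m) (bin_of_nat n) e => [|p] [|q] //=.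
- by case: q.
- by case: p.
- by move/pos_bits_inj->.
Qed.

Lemma enc_var_cat x y u v :
  enc_var x ++ u = enc_var y ++ v -> x = y /\ u = v.
Proof.
rewrite /enc_var !cat_rcons => e.
suff [/nat_bits_inj -> ->] : nat_bits x = nat_bits y /\ u = v by [].
elim: (nat_bits x) (nat_bits y) e => [|a s IH] [|b r] //= [].
  by move->.
by move=> -> /IH [-> ->].
Qed.

Lemma enc_vars_cat a xs ys u v : (forall b, a <> SBit b) -> a <> SHash ->
  enc_vars xs ++ a :: u = enc_vars ys ++ a :: v -> xs = ys /\ u = v.
Proof.
move=> aB aH; have ne x w r : a :: r <> enc_var x ++ w.
  by rewrite /enc_var; case: (nat_bits x) => [|b s] /= [] // /aB.
rewrite /enc_vars; elim: xs ys => [|x xs IH] [|y ys] /=.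
- by case.
- by rewrite -catA => /ne.
- by rewrite -catA => /esym/ne.
- by rewrite -!catA => /enc_var_cat [-> /IH [-> ->]].
Qed.

Lemma enc_cat phi psi u v :
  enc phi ++ u = enc psi ++ v -> phi = psi /\ u = v.
Proof.
elim: phi psi u v => [||x|x|n xs ys|p IHp q IHq|p IHp q IHq];
  case=> [||x'|x'|n' xs' ys'|p' q'|p' q'] u v //=.
- by case.
- by case.
- by case=> /enc_var_cat [-> ->].
- by case=> /enc_var_cat [-> ->].
- case; rewrite -!catA /= -!catA.
  move=> /enc_vars_cat [] // exs /enc_vars_cat [] // eys ->.
  have en : n = n' by rewrite -(size_tuple xs) -(size_tuple xs') exs.
  subst n'; split=> //.
  by congr PInc; apply: val_inj.
- by case; rewrite -!catA => /IHp [-> /IHq [-> ->]].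
- by case; rewrite -!catA => /IHp [-> /IHq [-> ->]].
Qed.

Lemma enc_inj : injective enc.
Proof.
move=> phi psi e; have: enc phi ++ [::] = enc psi ++ [::] by rewrite e.
by case/enc_cat.
Qed.

(* Main.v *)
Require Import Defs.
From mathcomp Require Import all_boot ssralg poly finmap.
From mathcomp Require Import boolp zify.
Set Implicit Arguments.
Unset Strict Implicit.
Unset Printing Implicit Defensive.

(* Let n be the size of phi and k its arity.  A team satisfying phi comes with
   a subteam for every subformula; it can be thinned out to one assignment of
   the subteam for each pair of an inclusion atom x <= y and a pattern of bits
   occurring on y, and at least one assignment altogether, so that
   (n + 1) * 2 ^ k assignments suffice.  Conversely, let every assignment of a
   list choose one disjunct at each disjunction that it reaches.  These choices
   prove that the list satisfies phi as soon as literals hold wherever they are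
   reached and every pattern that is needed at an inclusion atom (on x) is
   provided at the same atom (on y).

   So the machine guesses (n + 1) * 2 ^ k assignments one after the other and
   evaluates each of them in a single pass over the Polish notation, with a
   stack of flags.  Comparing the assignments pairwise would take time 4 ^ k;
   instead the needed and the provided patterns are marked in two tables, at
   the address pos + (n + 1) * pattern, and the tables are compared at the
   end.

   The bits that a run guesses are made an argument of the machine, which
   turns its correctness into the symbolic execution of a deterministic
   structured program. *)

(** * Runs with prescribed guesses *)

(** The arity is not part of the input: the machine learns [2 ^ k] while parsing, from a weight that
    it doubles along each tuple. Positions of atoms are at most n, so a pair of position and pattern
    has an address below [(n + 1) * 2 ^ k]. This number bounds both the tables and the passes, and
    completeness devotes one pass to each address: the pass follows an assignment providing the
    pattern with this address, if the team has one. Each pass must print a value for every variable,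
    so it also reads the disjuncts to which its assignment is not sent, with flag 0. The variables
    are numbered in binary, and a table of literals indexed by them is too large to be wiped between
    passes; its entries are stamped with the number of the pass instead. An assignment may lie in
    both subteams of a disjunction. It can then be guessed in several passes with different choices,
    which is how it provides patterns on both sides. Words that encode no formula must be rejected
    in time as well. Hence the specifications follow the unread input rather than a given formula,
    and describe failing runs as carefully as successful ones. *)

Definition dstep (P : program) (cg : config * seq bool) :
    option (config * seq bool) :=
  omap (fun c => (c, if onth P (pc cg.1) is Some (IGuess _) then behead cg.2
                     else cg.2))
    (step P (head false cg.2) cg.1).

Fixpoint drun (P : program) (n : nat) (cg : config * seq bool) :=
  if n is n'.+1 then obind (drun P n') (dstep P cg) else Some cg.

Lemma drunD P m n cg : drun P (m + n) cg = obind (drun P n) (drun P m cg).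
Proof. by elim: m cg => //= m IH cg; case: dstep => //= cg'. Qed.

Lemma drun_cat P m n cg cg1 :
  drun P m cg = Some cg1 -> drun P (m + n) cg = drun P n cg1.
Proof. by rewrite drunD => ->. Qed.

Lemma drun_reaches P n c g c' g' :
  drun P n (c, g) = Some (c', g') -> reaches P n c c'.
Proof.
elim: n c g => [|n IH] c g /=; first by case.
rewrite /dstep /=; case e: step => [c1|] //= /IH r.
by exists (head false g), c1.
Qed.

(** The list is built backwards along the run and receives a bit only at [IGuess], the bit of any
    other step being irrelevant; it is therefore used up exactly at [c']. *)
Lemma reaches_drun P n c c' :
  reaches P n c c' -> exists g, drun P n (c, g) = Some (c', [::]).
Proof.
elim: n c => [|n IH] c /=; first by move=> ->; exists [::].
case=> b [c1 [e /IH [g eg]]].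
case: (boolP (if onth P (pc c) is Some (IGuess _) then true else false)) => h.
  exists (b :: g); rewrite /dstep /= e /=.
  by case: onth h => [[]|].
exists g; rewrite /dstep /=.
have -> : step P (head false g) c = step P b c.
  case: c e h => l m u o _ /=.
  by case: onth => [[]|].
rewrite e /=.
by case: onth h => [[]|].
Qed.

(** Determinism: for fixed guesses, one halting run bounds the length of all runs, which yields time
    bounds, and determines where a run can halt, which yields outputs. *)
Lemma drun_halt P n1 n2 cg cg1 cg2 :
  drun P n1 cg = Some cg1 -> dstep P cg1 = None -> drun P n2 cg = Some cg2 ->
  n2 <= n1 /\ (dstep P cg2 = None -> cg2 = cg1).
Proof.
elim: n1 n2 cg => [|n1 IH] [|n2] cg /=.
- by case=> -> _ [->].
- by case=> <- ->.
- by case e: (dstep P cg) => [cg'|] //= _ _ [<-]; rewrite e.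
- by case: (dstep P cg) => [cg'|] //= e h /(IH _ _ e h).
Qed.

Definition code_at (P : program) (l : nat) (s : program) : Prop :=
  forall j, j < size s -> onth P (l + j) = onth s j.

Lemma code_at_cat P l s1 s2 :
  code_at P l (s1 ++ s2) -> code_at P l s1 /\ code_at P (l + size s1) s2.
Proof.
move=> h; split=> j jlt.
  by rewrite h ?onth_cat ?jlt // size_cat ltn_addr.
rewrite -addnA h ?size_cat ?ltn_add2l // onth_cat.
by rewrite ltnNge leq_addr /= addKn.
Qed.

Lemma code_at_cons P l i s :
  code_at P l (i :: s) -> onth P l = Some i /\ code_at P l.+1 s.
Proof.
move=> h; split; first by rewrite -[l]addn0 h.
by move=> j jlt; rewrite addSnnS h.
Qed.

(** * A structured language and its translation *)

(** [TOK] stores the input word, [STK] the flags of the pending subformulas, [CELL] the stamps of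
    the literals, [NEED] and [HAVE] the two tables of patterns. *)
Inductive arr := TOK | STK | CELL | NEED | HAVE.

Definition aidx (a : arr) : nat :=
  match a with TOK => 0 | STK => 1 | CELL => 2 | NEED => 3 | HAVE => 4 end.

Inductive exp :=
| Cst of nat
| Reg of nat
| Plus of exp & exp
| Minus of exp & exp
| Get of arr & exp.

Inductive cmd :=
| Skip
| Fail
| Assign of nat & exp
| Put of arr & exp & exp
| Guess of nat
| Read of nat
| Print of exp
| Seq of cmd & cmd
| If of exp & cmd & cmd
| While of exp & cmd.

(** Registers and arrays form lists, so that commands on explicitly listed states evaluate by
    simplification. [tick] counts elementary commands and tests; [unit_cost] converts it to machine
    steps. *)
Record state := State {
  rg : seq nat;
  ar : seq (nat -> nat);
  inp : seq nat;
  out : seq nat;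
  orc : seq bool;
  tick : nat
}.

Definition aget (s : seq (nat -> nat)) (a : arr) : nat -> nat :=
  nth (fun=> 0) s (aidx a).

Fixpoint eval (e : exp) (s : state) : nat :=
  match e with
  | Cst c => c
  | Reg r => nth 0 (rg s) r
  | Plus e1 e2 => eval e1 s + eval e2 s
  | Minus e1 e2 => eval e1 s - eval e2 s
  | Get a e => aget (ar s) a (eval e s)
  end.

Definition setr (s : state) (r v : nat) : state :=
  let: State rs aa u o g n := s in State (set_nth 0 rs r v) aa u o g n.+1.

Definition seta (s : state) (a : arr) (i v : nat) : state :=
  let: State rs aa u o g n := s in
  State rs (set_nth (fun=> 0) aa (aidx a) (upd (aget aa a) i v)) u o g n.+1.

Definition tic (s : state) : state :=
  let: State rs aa u o g n := s in State rs aa u o g n.+1.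

Definition guess (s : state) (r : nat) : state :=
  let: State rs aa u o g n := s in
  State (set_nth 0 rs r (nat_of_bool (head false g))) aa u o (behead g) n.+1.

Definition read (s : state) (r : nat) : state :=
  let: State rs aa u o g n := s in
  State (set_nth 0 rs r (head 0 u)) aa (behead u) o g n.+1.

Definition print (s : state) (v : nat) : state :=
  let: State rs aa u o g n := s in State rs aa u (rcons o v) g n.+1.

Inductive res := Ok of state | Ko of nat.

(** Failure carries its time, as rejecting runs have to be bounded too. *)
Inductive ev : cmd -> state -> res -> Prop :=
| ev_skip s : ev Skip s (Ok s)
| ev_fail s : ev Fail s (Ko (tick s).+1)
| ev_assign r e s : ev (Assign r e) s (Ok (setr s r (eval e s)))
| ev_put a e1 e2 s : ev (Put a e1 e2) s (Ok (seta s a (eval e1 s) (eval e2 s)))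
| ev_guess r s : ev (Guess r) s (Ok (guess s r))
| ev_read r s : ev (Read r) s (Ok (read s r))
| ev_print e s : ev (Print e) s (Ok (print s (eval e s)))
| ev_seq c1 c2 s s1 r : ev c1 s (Ok s1) -> ev c2 s1 r -> ev (Seq c1 c2) s r
| ev_seqF c1 c2 s t : ev c1 s (Ko t) -> ev (Seq c1 c2) s (Ko t)
| ev_if e c1 c2 s r :
    ev (if 0 < eval e s then c1 else c2) (tic s) r -> ev (If e c1 c2) s r
| ev_while0 e c s : eval e s = 0 -> ev (While e c) s (Ok (tic s))
| ev_while1 e c s s1 r : 0 < eval e s -> ev c (tic s) (Ok s1) ->
    ev (While e c) s1 r -> ev (While e c) s r
| ev_whileF e c s t : 0 < eval e s -> ev c (tic s) (Ko t) ->
    ev (While e c) s (Ko t).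

(* Register [r], the [k]-th scratch cell and the [i]-th entry of an array [a]
   live at the addresses [8 * r], [8 * k + 1] and [8 * i + (2 + aidx a)]. *)
Definition caddr (a : arr) (k : nat) : program :=
  let x := 8 * k + 1 in
  [:: IAdd x x x; IAdd x x x; IAdd x x x; IConst (x + 8) (2 + aidx a);
      IAdd x x (x + 8)].

(** The value ends in the [k]-th scratch cell and only scratch cells from [k] on are overwritten, so
    a second operand can be computed in the next cell. *)
Fixpoint cexp (e : exp) (k : nat) : program :=
  let x := 8 * k + 1 in
  match e with
  | Cst c => [:: IConst x c]
  | Reg r => [:: IConst x 0; IAdd x x (8 * r)]
  | Plus e1 e2 => cexp e1 k ++ cexp e2 k.+1 ++ [:: IAdd x x (x + 8)]
  | Minus e1 e2 => cexp e1 k ++ cexp e2 k.+1 ++ [:: ISub x x (x + 8)]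
  | Get a e => (cexp e k ++ caddr a k) ++ [:: ILoad x x]
  end.

(** [l] is the address at which the code is placed and [f] the target of failure; jumps are
    absolute. Putting 1 into the scratch cell at address 1 makes the next [IJumpPos 1]
    unconditional. *)
Fixpoint translate (f l : nat) (c : cmd) : program :=
  match c with
  | Skip => [::]
  | Fail => [:: IConst 1 1; IJumpPos 1 f]
  | Assign r e => cexp e 0 ++ [:: IConst (8 * r) 0; IAdd (8 * r) (8 * r) 1]
  | Put a e1 e2 => (cexp e1 0 ++ caddr a 0) ++ cexp e2 1 ++ [:: IStore 1 9]
  | Guess r => [:: IGuess (8 * r)]
  | Read r => [:: IRead (8 * r)]
  | Print e => cexp e 0 ++ [:: IPrint 1]
  | Seq c1 c2 => let C1 := translate f l c1 in C1 ++ translate f (l + size C1) c2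
  | If e c1 c2 =>
      let C0 := cexp e 0 in
      let C2 := translate f (l + size C0).+1 c2 in
      let l1 := (l + size C0).+1 + size C2 + 2 in
      let C1 := translate f l1 c1 in
      C0 ++ IJumpPos 1 l1 ::
      C2 ++ IConst 1 1 :: IJumpPos 1 (l1 + size C1) :: C1
  | While e c =>
      let C0 := cexp e 0 in
      let l1 := l + size C0 + 3 in
      let C := translate f l1 c in
      C0 ++ IJumpPos 1 l1 :: IConst 1 1 :: IJumpPos 1 (l1 + size C + 2) ::
      C ++ [:: IConst 1 1; IJumpPos 1 l]
  end.

(** * Cost and correctness of the translation *)

Definition esize (e : exp) : nat := size (cexp e 0).

Fixpoint unit_cost (c : cmd) : nat :=
  match c with
  | Skip | Fail | Guess _ | Read _ => 2
  | Assign _ e => esize e + 2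
  | Put a e1 e2 => esize e1 + (5 + (size (cexp e2 1) + 1))
  | Print e => esize e + 1
  | Seq c1 c2 => maxn (unit_cost c1) (unit_cost c2)
  | If e c1 c2 => maxn (esize e + 3) (maxn (unit_cost c1) (unit_cost c2))
  | While e c => maxn (esize e + 3) (unit_cost c)
  end.

(** Addresses congruent to 1 modulo 8 stay unconstrained, for the scratch cells. Registers, scratch
    cells and five arrays occupy seven residues; the modulus is the next power of two, since [caddr]
    multiplies by doubling. *)
Definition repr (s : state) (m : nat -> nat) : Prop :=
  (forall r, m (8 * r) = nth 0 (rg s) r) /\
  (forall a i, m (8 * i + (2 + aidx a)) = aget (ar s) a i).

Lemma aidx_lt a : aidx a < 5. Proof. by case: a. Qed.

Lemma repr_scratch s m m' : repr s m ->
  (forall j, j %% 8 != 1 -> m' j = m j) -> repr s m'.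
Proof.
move=> [h1 h2] h; split=> [r|a i]; rewrite h ?h1 ?h2 //; first lia.
have := aidx_lt a; lia.
Qed.

Lemma dstep_pc P l m u o g i : onth P l = Some i ->
  dstep P (Config l m u o, g) =
  match i with
  | IConst i v => Some (Config l.+1 (upd m i v) u o, g)
  | IAdd i j k => Some (Config l.+1 (upd m i (m j + m k)) u o, g)
  | ISub i j k => Some (Config l.+1 (upd m i (m j - m k)) u o, g)
  | ILoad i j => Some (Config l.+1 (upd m i (m (m j))) u o, g)
  | IStore i j => Some (Config l.+1 (upd m (m i) (m j)) u o, g)
  | IJumpPos i l' => Some (Config (if 0 < m i then l' else l.+1) m u o, g)
  | IRead i => Some (Config l.+1 (upd m i (head 0 u)) (behead u) o, g)
  | IPrint i => Some (Config l.+1 m u (rcons o (m i)), g)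
  | IGuess i =>
      Some (Config l.+1 (upd m i (nat_of_bool (head false g))) u o, behead g)
  | IAccept => None
  end.
Proof. by rewrite /dstep /= => ->; case: i. Qed.

Lemma caddr_run P l a k m u o g :
  code_at P l (caddr a k) ->
  exists m', [/\ drun P 5 (Config l m u o, g) = Some (Config (l + 5) m' u o, g),
    m' (8 * k + 1) = 8 * m (8 * k + 1) + (2 + aidx a) &
    forall j, (j %% 8 != 1) || (j %/ 8 < k) -> m' j = m j].
Proof.
case/code_at_cons=> h1 /code_at_cons [h2 /code_at_cons [h3 /code_at_cons [h4]]].
case/code_at_cons=> h5 _.
eexists; split.
- rewrite /= (dstep_pc _ _ _ _ h1) /= (dstep_pc _ _ _ _ h2) /=.
  rewrite (dstep_pc _ _ _ _ h3) /= (dstep_pc _ _ _ _ h4) /=.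
  rewrite (dstep_pc _ _ _ _ h5) /=.
  by congr (Some (Config _ _ _ _, _)); lia.
- rewrite /upd; have -> : (8 * k + 1 + 8 == 8 * k + 1) = false by lia.
  rewrite !eqxx; have -> : (8 * k + 1 == 8 * k + 1 + 8) = false by lia.
  lia.
- move=> j hj; rewrite /upd.
  have -> : (j == 8 * k + 1 + 8) = false by lia.
  by have -> : (j == 8 * k + 1) = false by lia.
Qed.

Lemma cexp_run P e l k m u o g s :
  code_at P l (cexp e k) -> repr s m ->
  exists m', [/\ drun P (size (cexp e k)) (Config l m u o, g) =
                   Some (Config (l + size (cexp e k)) m' u o, g),
    m' (8 * k + 1) = eval e s &
    forall j, (j %% 8 != 1) || (j %/ 8 < k) -> m' j = m j].
Proof.
elim: e l k m => [c|r|e1 IH1 e2 IH2|e1 IH1 e2 IH2|a e IH] l k m /=.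
- case/code_at_cons=> h _ _; eexists; split.
  + rewrite /= (dstep_pc _ _ _ _ h) /=; congr (Some (Config _ _ _ _, _)); lia.
  + by rewrite /upd eqxx.
  + by move=> j hj; rewrite /upd; case: eqP => //; lia.
- case/code_at_cons=> h /code_at_cons [h' _] [hr _]; eexists; split.
  + rewrite /= (dstep_pc _ _ _ _ h) /= (dstep_pc _ _ _ _ h') /=.
    by congr (Some (Config _ _ _ _, _)); lia.
  + rewrite /upd !eqxx; have -> : (8 * r == 8 * k + 1) = false by lia.
    by rewrite hr.
  + by move=> j hj; rewrite /upd; case: eqP => //; lia.
- case/code_at_cat=> h1 /code_at_cat [h2 /code_at_cons [h _]] hr.
  have [m1 [r1 v1 f1]] := IH1 _ _ _ h1 hr.
  have hr1 : repr s m1 by apply: repr_scratch hr _ => j hj; rewrite f1 ?hj.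
  have [m2 [r2 v2 f2]] := IH2 _ _ _ h2 hr1.
  eexists; split.
  + rewrite !size_cat !drunD r1 /= drunD r2 /= (dstep_pc _ _ _ _ h) /=.
    by congr (Some (Config _ _ _ _, _)); lia.
  + rewrite /upd eqxx f2 ?v1; last by lia.
    by congr addn; rewrite -v2; congr m2; lia.
  + move=> j hj; rewrite /upd; case: eqP => [|_]; first lia.
    by rewrite f2 ?f1 //; lia.
- case/code_at_cat=> h1 /code_at_cat [h2 /code_at_cons [h _]] hr.
  have [m1 [r1 v1 f1]] := IH1 _ _ _ h1 hr.
  have hr1 : repr s m1 by apply: repr_scratch hr _ => j hj; rewrite f1 ?hj.
  have [m2 [r2 v2 f2]] := IH2 _ _ _ h2 hr1.
  eexists; split.
  + rewrite !size_cat !drunD r1 /= drunD r2 /= (dstep_pc _ _ _ _ h) /=.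
    by congr (Some (Config _ _ _ _, _)); lia.
  + rewrite /upd eqxx f2 ?v1; last by lia.
    by congr subn; rewrite -v2; congr m2; lia.
  + move=> j hj; rewrite /upd; case: eqP => [|_]; first lia.
    by rewrite f2 ?f1 //; lia.
- case/code_at_cat=> /code_at_cat [h1 h2]; rewrite size_cat addnA.
  case/code_at_cons=> h _ hr; have [m1 [r1 v1 f1]] := IH _ _ _ h1 hr.
  have [m2 [r2 v2 f2]] := caddr_run m1 u o g h2.
  eexists; split.
  + rewrite !size_cat (_ : size (caddr a k) = 5) // -addnA.
    rewrite (drun_cat _ r1) (drun_cat _ r2) /= (dstep_pc _ _ _ _ h) /=.
    by congr (Some (Config _ _ _ _, _)); lia.
  + rewrite /upd eqxx v2 v1 f2 ?f1; first by case: hr.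
      have := aidx_lt a; lia.
    have := aidx_lt a; lia.
  + move=> j hj; rewrite /upd; case: eqP => [|_]; first lia.
    by rewrite f2 ?f1 //; lia.
Qed.

Definition config_of (s : state) (l : nat) (m : nat -> nat) : config * seq bool :=
  (Config l m (inp s) (out s), orc s).

Lemma exp_run P e l m s : code_at P l (cexp e 0) -> repr s m ->
  exists m', [/\ drun P (esize e) (config_of s l m) =
                   Some (config_of s (l + esize e) m'),
    m' 1 = eval e s & repr s m'].
Proof.
move=> h hr; have [m' [r v f]] := cexp_run (inp s) (out s) (orc s) h hr.
exists m'; split=> //; apply: repr_scratch hr _ => j hj.
by rewrite f ?hj.
Qed.

Lemma jump_run P l l' m s : repr s m ->
  code_at P l [:: IConst 1 1; IJumpPos 1 l'] ->
  exists2 m', drun P 2 (config_of s l m) = Some (config_of s l' m') & repr s m'.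
Proof.
move=> hr /code_at_cons [h1 /code_at_cons [h2 _]]; exists (upd m 1 1).
  by rewrite /= (dstep_pc _ _ _ _ h1) /= (dstep_pc _ _ _ _ h2).
by apply: repr_scratch hr _ => j hj; rewrite /upd; case: eqP => //; lia.
Qed.

Lemma repr_setr s r v m :
  repr s m -> repr (setr s r v) (upd m (8 * r) v).
Proof.
case: s => rs aa u o g n [/= h1 h2]; split=> /= [r'|a i].
  rewrite nth_set_nth /= -h1 /upd.
  by have -> : (8 * r' == 8 * r) = (r' == r) by lia.
rewrite /upd; case: eqP => [|_]; last exact: h2.
have := aidx_lt a; lia.
Qed.

Lemma repr_seta s a i v m :
  repr s m -> repr (seta s a i v) (upd m (8 * i + (2 + aidx a)) v).
Proof.
case: s => rs aa u o g n [/= h1 h2]; split=> /= [r'|a' i'].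
  rewrite /upd; case: eqP => [|_]; last exact: h1.
  have := aidx_lt a; lia.
have := aidx_lt a; have := aidx_lt a'.
rewrite /aget nth_set_nth /= /upd; case: (aidx a' =P aidx a) => [e|ne] lt lt'.
  have -> : (8 * i' + (2 + aidx a') == 8 * i + (2 + aidx a)) = (i' == i) by lia.
  by case: eqP => // _; rewrite h2 /aget e.
by case: eqP => [|_]; [lia | rewrite h2].
Qed.

Lemma drun1 P cg : drun P 1 cg = dstep P cg.
Proof. by rewrite /=; case: dstep. Qed.

(** Each tick pays for [K] machine steps. Induction on the evaluation takes care of loops, and one
    [K] for all subcommands makes their bounds add up. *)
Lemma translate_run K P f c s r : ev c s r -> unit_cost c <= K ->
  forall l m, code_at P l (translate f l c) -> repr s m ->
  match r with
  | Ok s' => exists n m', [/\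
      drun P n (config_of s l m) = Some (config_of s' (l + size (translate f l c)) m'),
      repr s' m' & n + K * tick s <= K * tick s']
  | Ko t => exists n cg, [/\ drun P n (config_of s l m) = Some cg,
      pc cg.1 = f & n + K * tick s <= K * t]
  end.
Proof.
elim=> {c s r}.
- move=> s _ l m _ hr; exists 0, m; rewrite addn0; split=> //.
- move=> s /= hK l m hc hr; have [m' e hr'] := jump_run hr hc.
  by exists 2, (config_of s f m'); split=> //; rewrite mulnS leq_add2r.
- move=> r e s /= hK l m /code_at_cat [he].
  case/code_at_cons=> h1 /code_at_cons [h2 _] hr.
  have [m' [r1 v hr']] := exp_run he hr.
  exists (esize e + 2), (upd (upd m' (8 * r) 0) (8 * r) (eval e s)); split.
  + rewrite (drun_cat _ r1) /= (dstep_pc _ _ _ _ h1) /= (dstep_pc _ _ _ _ h2) /=.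
    rewrite /upd eqxx; have -> : (1 == 8 * r) = false by lia.
    rewrite v add0n /config_of; case: (s) => ? ? ? ? ? ? /=; rewrite /= size_cat.
    by congr (Some (Config _ _ _ _, _)); rewrite -/(esize e) /=; lia.
  + have := repr_setr r (eval e s) hr'.
    congr repr; apply/funext => j; rewrite /upd; by case: eqP.
  + by case: (s) => ? ? ? ? ? ? /=; rewrite mulnS leq_add2r.
- move=> a e1 e2 s /= hK l m /code_at_cat [/code_at_cat [he1 ha]].
  rewrite size_cat addnA; case/code_at_cat=> he2 /code_at_cons [h _] hr.
  have [m1 [r1 v1 hr1]] := exp_run he1 hr.
  have [m2 [r2 v2 f2]] := caddr_run m1 (inp s) (out s) (orc s) ha.
  have hr2 : repr s m2 by apply: repr_scratch hr1 _ => j hj; rewrite f2 ?hj.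
  have [m3 [r3 v3 f3]] := cexp_run (inp s) (out s) (orc s) he2 hr2.
  have hr3 : repr s m3.
    by apply: repr_scratch hr2 _ => j hj; rewrite f3 ?hj.
  exists (esize e1 + (5 + (size (cexp e2 1) + 1))).
  exists (upd m3 (8 * eval e1 s + (2 + aidx a)) (eval e2 s)); split.
  + rewrite (drun_cat _ r1) (drun_cat _ r2) (drun_cat _ r3).
    rewrite ?/config_of drun1 (dstep_pc _ _ _ _ h).
    rewrite f3 // v2 v1 (v3 : m3 9 = _).
    rewrite /config_of; case: (s) => ? ? ? ? ? ? /=; rewrite !size_cat /=.
    by congr (Some (Config _ _ _ _, _)); rewrite -/(esize e1) /=; lia.
  + exact: repr_seta.
  + by case: (s) => ? ? ? ? ? ? /=; rewrite mulnS leq_add2r.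
- move=> r s /= hK l m /code_at_cons [h _] hr.
  exists 1, (upd m (8 * r) (nat_of_bool (head false (orc s)))); split.
  + rewrite ?/config_of drun1 (dstep_pc _ _ _ _ h).
    by rewrite /config_of; case: (s) => ? ? ? ? ? ? /=; rewrite addn1.
  + by have := repr_setr r (nat_of_bool (head false (orc s))) hr; case: (s).
  + case: (s) => ? ? ? ? ? ? /=; lia.
- move=> r s /= hK l m /code_at_cons [h _] hr.
  exists 1, (upd m (8 * r) (head 0 (inp s))); split.
  + rewrite ?/config_of drun1 (dstep_pc _ _ _ _ h).
    by rewrite /config_of; case: (s) => ? ? ? ? ? ? /=; rewrite addn1.
  + by have := repr_setr r (head 0 (inp s)) hr; case: (s).
  + case: (s) => ? ? ? ? ? ? /=; lia.
- move=> e s /= hK l m /code_at_cat [he /code_at_cons [h _]] hr.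
  have [m' [r1 v hr']] := exp_run he hr.
  exists (esize e + 1), m'; split.
  + rewrite (drun_cat _ r1) /config_of drun1 (dstep_pc _ _ _ _ h) v.
    rewrite /config_of; case: (s) => ? ? ? ? ? ? /=; rewrite size_cat.
    by congr (Some (Config _ _ _ _, _)); rewrite -/(esize e) /=; lia.
  + by move: hr'; case: (s).
  + case: (s) => ? ? ? ? ? ? /=; lia.
- move=> c1 c2 s s1 r _ IH1 _ IH2 /=; rewrite geq_max => /andP [hK1 hK2] l m.
  case/code_at_cat=> hc1 hc2 hr.
  have [n1 [m1 [r1 hr1 t1]]] := IH1 hK1 _ _ hc1 hr.
  move: (IH2 hK2 _ _ hc2 hr1); case: r {IH2} => [s2|t] [n2 [x [r2 hr2 t2]]].
  + exists (n1 + n2), x; split=> //; last lia.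
    by rewrite (drun_cat _ r1) r2 size_cat addnA.
  + by exists (n1 + n2), x; split=> //; [rewrite (drun_cat _ r1) | lia].
- move=> c1 c2 s t _ IH1 /=; rewrite geq_max => /andP [hK1 hK2] l m.
  by case/code_at_cat=> hc1 hc2 hr; apply: IH1 hK1 _ _ hc1 hr.
- move=> e c1 c2 s r _ IH /=; rewrite !geq_max => /and3P [hK hK1 hK2] l m.
  case/code_at_cat=> he /code_at_cons [hj /code_at_cat [hc2]].
  set C2 := translate f _ c2 in hj hc2 *; set l1 := (_ + size C2 + 2).
  move=> hh hr; have := hh.
  rewrite -[_ :: _ :: _]/([:: IConst 1 1;
    IJumpPos 1 (l1 + size (translate f l1 c1))] ++ _).
  case/code_at_cat => hjj hc1.
  have [m1 [r1 v1 hr1]] := exp_run he hr.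
  have hr1' : repr (tic s) m1 by move: hr1; case: (s).
  have et : config_of (tic s) =2 config_of s by case: (s).
  have tt : tick (tic s) = (tick s).+1 by case: (s).
  have r1' : drun P (esize e).+1 (config_of s l m) =
    Some (config_of s (if 0 < eval e s then l1 else (l + size (cexp e 0)).+1) m1).
    by rewrite -addn1 (drun_cat _ r1) /config_of drun1
      (dstep_pc _ _ _ _ hj) v1.
  move: IH; case: ifP r1' => he0 r1' IH.
  + have l1E : (l + size (cexp e 0)).+1 + size C2 +
        size [:: IConst 1 1; IJumpPos 1 (l1 + size (translate f l1 c1))] = l1.
      by [].
    rewrite l1E in hc1.
    move: (IH hK1 _ _ hc1 hr1'); rewrite tt; case: {IH} r => [s2|t] [n2 [x [r2 hr2 t2]]].
    * exists ((esize e).+1 + n2), x; split=> //; last lia.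
      rewrite (drun_cat _ r1') -et r2; congr (Some (config_of _ _ _)).
      rewrite size_cat /= size_cat /= /l1; lia.
    * by exists ((esize e).+1 + n2), x; split=> //; [rewrite (drun_cat _ r1') -et | lia].
  + move: (IH hK2 _ _ hc2 hr1'); rewrite tt; case: {IH} r => [s2|t] [n2 [x [r2 hr2 t2]]].
    * have [m3 r3 hr3] := jump_run hr2 hjj.
      exists ((esize e).+1 + (n2 + 2)), m3; split=> //; last lia.
      rewrite (drun_cat _ r1') -et (drun_cat _ r2) r3; congr (Some (config_of _ _ _)).
      rewrite size_cat /= size_cat /= /l1; lia.
    * by exists ((esize e).+1 + n2), x; split=> //; [rewrite (drun_cat _ r1') -et | lia].
- move=> e c s e0 /=; rewrite !geq_max => /andP [hK hKc] l m.
  case/code_at_cat=> he /code_at_cons [hj].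
  set C := translate f _ c; set l1 := l + _ + 3.
  rewrite -[_ :: _ :: _]/([:: IConst 1 1; IJumpPos 1 (l1 + size C + 2)] ++ _).
  case/code_at_cat=> hjj _ hr.
  have [m1 [r1 v1 hr1]] := exp_run he hr.
  have r1' : drun P (esize e).+1 (config_of s l m) =
    Some (config_of s (l + size (cexp e 0)).+1 m1).
    by rewrite -addn1 (drun_cat _ r1) /config_of drun1
      (dstep_pc _ _ _ _ hj) v1 e0.
  have [m2 r2 hr2] := jump_run hr1 hjj.
  exists ((esize e).+1 + 2), m2; split.
  + rewrite (drun_cat _ r1') r2 size_cat /= size_cat.
    case: (s) => ? ? ? ? ? ? /=; rewrite /config_of /=.
    by congr (Some (Config _ _ _ _, _)); rewrite /= /l1; lia.
  + by move: hr2; case: (s).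
  + case: (s) => ? ? ? ? ? ? /=; lia.
- move=> e c s s1 r e0 _ IH1 _ IH2 hKK l m hcc hr; have := hcc.
  have := hKK; rewrite /= geq_max => /andP [hK hKc].
  case/code_at_cat=> he /code_at_cons [hj].
  set C := translate f _ c; set l1 := l + _ + 3.
  rewrite -[_ :: _ :: _]/([:: IConst 1 1; IJumpPos 1 (l1 + size C + 2)] ++ _).
  case/code_at_cat=> hjj /code_at_cat [hc hjb].
  have [m1 [r1 v1 hr1]] := exp_run he hr.
  have hr1' : repr (tic s) m1 by move: hr1; case: (s).
  have et : config_of (tic s) =2 config_of s by case: (s).
  have tt : tick (tic s) = (tick s).+1 by case: (s).
  have r1' : drun P (esize e).+1 (config_of s l m) = Some (config_of s l1 m1).
    by rewrite -addn1 (drun_cat _ r1) /config_of drun1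
      (dstep_pc _ _ _ _ hj) v1 e0.
  have l1E : (l + size (cexp e 0)).+1 +
      size [:: IConst 1 1; IJumpPos 1 (l1 + size C + 2)] = l1.
    by rewrite /l1 /=; lia.
  rewrite l1E in hc hjb.
  have [n2 [m2 [r2 hr2 t2]]] := IH1 hKc _ _ hc hr1'.
  have [m3 r3 hr3] := jump_run hr2 hjb.
  move: (IH2 hKK _ _ hcc hr3); case: r {IH2} => [s2|t] [n4 [x [r4 hr4 t4]]].
  + exists ((esize e).+1 + (n2 + (2 + n4))), x; split=> //; last lia.
    by rewrite (drun_cat _ r1') -et (drun_cat _ r2) (drun_cat _ r3).
  + exists ((esize e).+1 + (n2 + (2 + n4))), x; split=> //; last lia.
    by rewrite (drun_cat _ r1') -et (drun_cat _ r2) (drun_cat _ r3).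
- move=> e c s t e0 _ IH1 hKK l m hcc hr; have := hcc.
  have := hKK; rewrite /= geq_max => /andP [hK hKc].
  case/code_at_cat=> he /code_at_cons [hj].
  set C := translate f _ c; set l1 := l + _ + 3.
  rewrite -[_ :: _ :: _]/([:: IConst 1 1; IJumpPos 1 (l1 + size C + 2)] ++ _).
  case/code_at_cat=> hjj /code_at_cat [hc hjb].
  have [m1 [r1 v1 hr1]] := exp_run he hr.
  have hr1' : repr (tic s) m1 by move: hr1; case: (s).
  have et : config_of (tic s) =2 config_of s by case: (s).
  have tt : tick (tic s) = (tick s).+1 by case: (s).
  have r1' : drun P (esize e).+1 (config_of s l m) = Some (config_of s l1 m1).
    by rewrite -addn1 (drun_cat _ r1) /config_of drun1
      (dstep_pc _ _ _ _ hj) v1 e0.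
  have l1E : (l + size (cexp e 0)).+1 +
      size [:: IConst 1 1; IJumpPos 1 (l1 + size C + 2)] = l1.
    by rewrite /l1 /=; lia.
  rewrite l1E in hc.
  have [n2 [x [r2 hr2 t2]]] := IH1 hKc _ _ hc hr1'.
  exists ((esize e).+1 + n2), x; split=> //; last lia.
  by rewrite (drun_cat _ r1') -et.
Qed.

(* Failing jumps past the final [IAccept]. *)
Definition compile (c : cmd) : program :=
  rcons (translate (size (translate 0 0 c)).+1 0 c) IAccept.

(** Jump targets do not affect the length, so the failure address can be computed from a translation
    with dummy targets. *)
Lemma size_translate f l f' l' c : size (translate f l c) = size (translate f' l' c).
Proof.
elim: c f l f' l' => //= [c1 IH1 c2 IH2|e c1 IH1 c2 IH2|e c IH] f l f' l'.
- by rewrite !size_cat (IH1 f l f' l'); congr addn; exact: IH2.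
- by rewrite !size_cat /= !size_cat /=; congr (_ + (_ + _).+1);
    [exact: IH2 | congr _.+2; exact: IH1].
- by rewrite !size_cat /= !size_cat /=; congr (_ + (_ + _).+3); exact: IH.
Qed.

(** * Runs of compiled programs *)

Definition start (w : seq nat) (g : seq bool) : state :=
  State (nseq 16 0) (nseq 5 (fun=> 0)) w [::] g 0.

Definition time (r : res) : nat := match r with Ok s => tick s | Ko t => t end.

Lemma repr_start w g : repr (start w g) (fun=> 0).
Proof. by split=> [r|[] i] //=; rewrite (nth_nseq 0 16 0) if_same. Qed.

Lemma compile_run c w g r : ev c (start w g) r ->
  exists n cg, [/\ drun (compile c) n (init w, g) = Some cg,
    dstep (compile c) cg = None, n <= unit_cost c * time r &
    match r with
    | Ok s => accepting (compile c) cg.1 /\ output cg.1 = out s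
    | Ko _ => ~ accepting (compile c) cg.1
    end].
Proof.
move=> h; set P := compile c; set f := (size (translate 0 0 c)).+1.
have hc : code_at P 0 (translate f 0 c).
  by move=> j lt; rewrite /P /compile -cats1 onth_cat lt.
have sz : size (translate f 0 c) = size (translate 0 0 c) by exact: size_translate.
have acc : onth P (size (translate 0 0 c)) = Some IAccept.
  by rewrite /P /compile -cats1 onth_cat sz ltnn subnn.
have rej : onth P f = None.
  by apply: onth_default; rewrite /P /compile size_rcons sz.
have := translate_run h (leqnn _) hc (repr_start w g).
case: r {h} => [s [n [m [r hr t]]]|t [n [cg [r p tt]]]].
  exists n, (config_of s (0 + size (translate f 0 c)) m); split=> //.
  - by rewrite /config_of add0n sz (dstep_pc _ _ _ _ acc).
  - by move: t; rewrite muln0 addn0.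
  - by rewrite /accepting /= sz.
exists n, cg; split=> //.
- by case: cg p {r} => [[l m u o] gg] /= p; rewrite /dstep /= p rej.
- by move: tt; rewrite muln0 addn0.
- by rewrite /accepting p rej.
Qed.

Lemma accepts_compile c w g s :
  ev c (start w g) (Ok s) -> accepts (compile c) w (out s).
Proof.
case/compile_run=> n [[c' g'] [/drun_reaches r _ _ [a o]]].
by exists n, c'.
Qed.

(** The evaluation is run with the guesses of the accepting run; by determinism both halt in the
    same configuration. *)
Lemma compile_accepts c w o (Q : seq bool -> res -> Prop) :
  (forall g, exists2 r, ev c (start w g) r & Q g r) ->
  accepts (compile c) w o -> exists g s, Q g (Ok s) /\ out s = o.
Proof.
move=> h [n [c' [/reaches_drun [g r] a <-]]].
have [r' e q] := h g; have [n' [cg [r1 st _ hr]]] := compile_run e.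
have [_ /(_ _)] := drun_halt r1 st r.
have -> : dstep (compile c) (c', [::]) = None.
  by case: c' a {r} => l m u oo /= a; rewrite (dstep_pc _ _ _ _ a).
move=> /(_ erefl) ec; move: hr; rewrite -ec; case: r' e q => [s|t] e q //.
by case=> _ /= ->; exists g, s.
Qed.

Lemma compile_within c w t :
  (forall g, exists2 r, ev c (start w g) r & unit_cost c * time r <= t) ->
  runs_within (compile c) w t.
Proof.
move=> h n c' /reaches_drun [g r]; have [r' e le] := h g.
have [n' [cg [r1 st len _]]] := compile_run e.
by have [lt _] := drun_halt r1 st r; apply: leq_trans lt (leq_trans len le).
Qed.

(** * Symbolic execution, with postconditions on success and failure *)

Definition wp (c : cmd) (s : state) (K : res -> Prop) : Prop :=
  exists2 r, ev c s r & K r.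

Lemma wp_skip s (K : res -> Prop) : K (Ok s) -> wp Skip s K.
Proof. by move=> h; exists (Ok s) => //; constructor. Qed.

Lemma wp_fail s (K : res -> Prop) : K (Ko (tick s).+1) -> wp Fail s K.
Proof. by move=> h; eexists; [constructor | exact: h]. Qed.

Lemma wp_assign r e s (K : res -> Prop) :
  K (Ok (setr s r (eval e s))) -> wp (Assign r e) s K.
Proof. by move=> h; eexists; [constructor | exact: h]. Qed.

Lemma wp_put a e1 e2 s (K : res -> Prop) :
  K (Ok (seta s a (eval e1 s) (eval e2 s))) -> wp (Put a e1 e2) s K.
Proof. by move=> h; eexists; [constructor | exact: h]. Qed.

Lemma wp_guess r s (K : res -> Prop) : K (Ok (guess s r)) -> wp (Guess r) s K.
Proof. by move=> h; eexists; [constructor | exact: h]. Qed.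

Lemma wp_read r s (K : res -> Prop) : K (Ok (read s r)) -> wp (Read r) s K.
Proof. by move=> h; eexists; [constructor | exact: h]. Qed.

Lemma wp_print e s (K : res -> Prop) :
  K (Ok (print s (eval e s))) -> wp (Print e) s K.
Proof. by move=> h; eexists; [constructor | exact: h]. Qed.

Definition bind (f : state -> Prop) (K : res -> Prop) (r : res) : Prop :=
  match r with Ok s => f s | Ko t => K (Ko t) end.

Lemma wp_seq c1 c2 s (K : res -> Prop) :
  wp c1 s (bind (fun s1 => wp c2 s1 K) K) -> wp (Seq c1 c2) s K.
Proof.
case=> [[s1|t] e1 /= h]; last by exists (Ko t) => //; apply: ev_seqF.
by case: h => r e2 h; exists r => //; apply: ev_seq e1 e2.
Qed.

(** Serves a loop that begins a sequence: the goal about its remaining turns is folded back into one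
    about the whole sequence, to which the induction hypothesis applies. *)
Lemma wp_seq_inv c1 c2 s (K : res -> Prop) :
  wp (Seq c1 c2) s K -> wp c1 s (bind (fun s1 => wp c2 s1 K) K).
Proof.
case=> r e k; inversion e; subst.
  by exists (Ok s1) => //; exists r.
by exists (Ko t).
Qed.

(** Matching on a successor, instead of testing positivity, lets simplification choose the
    branch. *)
Lemma wp_if e c1 c2 s (K : res -> Prop) :
  wp (if eval e s is _.+1 then c1 else c2) (tic s) K -> wp (If e c1 c2) s K.
Proof.
by case=> r h k; exists r => //; constructor; case: (eval e s) h.
Qed.

Lemma wp_while0 e c s (K : res -> Prop) :
  eval e s = 0 -> K (Ok (tic s)) -> wp (While e c) s K.
Proof. by move=> h k; exists (Ok (tic s)) => //; constructor. Qed.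

Lemma wp_while1 e c s (K : res -> Prop) : 0 < eval e s ->
  wp c (tic s) (bind (fun s1 => wp (While e c) s1 K) K) -> wp (While e c) s K.
Proof.
move=> h [[s1|t] e1 /= k]; last by exists (Ko t) => //; apply: ev_whileF.
by case: k => r e2 k; exists r => //; apply: ev_while1 e1 e2.
Qed.

Lemma wp_mono c s (K K' : res -> Prop) :
  wp c s K -> (forall r, K r -> K' r) -> wp c s K'.
Proof. by case=> r e k h; exists r => //; apply: h. Qed.

Notation "c1 ;; c2" := (Seq c1 c2) (at level 70, right associativity).

(** * The program *)

(** [rP] is the position in the word, [rSP] the height of the stack, [rA] the flag, [rT] the token,
    [rB] the guessed bit, [rV] and [rW] the number being read and the weight of its next digit, [rQ]
    its last digit, [rI] the number of the pass, [rD] the length of the word plus one, [rL] the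
    bound on addresses, [rZ] and [rU] the address being formed and the weight of its next digit,
    [rX] and [rY] their values after the first tuple, [rE] the position recorded for an atom. *)
Notation rP := 0 (only parsing).
Notation rSP := 1 (only parsing).
Notation rA := 2 (only parsing).
Notation rT := 3 (only parsing).
Notation rB := 4 (only parsing).
Notation rV := 5 (only parsing).
Notation rW := 6 (only parsing).
Notation rQ := 7 (only parsing).
Notation rI := 8 (only parsing).
Notation rL := 9 (only parsing).
Notation rD := 10 (only parsing).
Notation rX := 11 (only parsing).
Notation rY := 12 (only parsing).
Notation rZ := 13 (only parsing).
Notation rU := 14 (only parsing).
Notation rE := 15 (only parsing).

Coercion Cst : nat >-> exp.

(** Digits have the codes 11 and 12. [rQ] keeps the last and most significant one, since a numeral
    with a leading zero must be rejected. *)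
Definition readbits : cmd :=
  While (Minus (Reg rT) 10)
    (Print (Reg rT) ;;
     Assign rQ (Minus (Reg rT) 11) ;;
     If (Reg rQ) (Assign rV (Plus (Reg rV) (Reg rW))) Skip ;;
     Assign rW (Plus (Reg rW) (Reg rW)) ;;
     Assign rT (Get TOK (Reg rP)) ;; Assign rP (Plus (Reg rP) 1)).

(* Reads the variable at [rP] into [rV], printing it as a literal of sign [rB];
   the sign is checked against the literals stamped with [rI] in [CELL]. *)
Definition readvar : cmd :=
  Print (Minus 4 (Reg rB)) ;;
  Assign rV 0 ;; Assign rW 1 ;; Assign rQ 1 ;;
  Assign rT (Get TOK (Reg rP)) ;; Assign rP (Plus (Reg rP) 1) ;;
  readbits ;;
  If (Minus 10 (Reg rT)) Fail Skip ;;
  If (Reg rQ) Skip Fail ;;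
  Print 10 ;;
  If (Minus (Reg rI) (Get CELL (Plus (Plus (Reg rV) (Reg rV)) (Minus 1 (Reg rB)))))
    Skip Fail ;;
  Put CELL (Plus (Plus (Reg rV) (Reg rV)) (Reg rB)) (Reg rI).

(* Reads variables up to the token [stop], adding to [rZ] the number whose
   binary digits are their values, multiplied by [rU]. *)
Definition readvars (stop : nat) : cmd :=
  While (Plus (Minus (Get TOK (Reg rP)) stop) (Minus stop (Get TOK (Reg rP))))
    (Guess rB ;; readvar ;;
     If (Reg rB) (Assign rZ (Plus (Reg rZ) (Reg rU))) Skip ;;
     Assign rU (Plus (Reg rU) (Reg rU))) ;;
  Assign rP (Plus (Reg rP) 1).

(** [rU] ends as [rD] times two to the length of a tuple. Comparing its two final values tests that
    the tuples are equally long, and [rL + (rU - rL)], a maximum, collects the bound on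
    addresses. *)
Definition do_inc : cmd :=
  Assign rE (Reg rP) ;;
  Assign rZ (Reg rE) ;; Assign rU (Reg rD) ;; readvars 6 ;;
  Assign rX (Reg rZ) ;; Assign rY (Reg rU) ;;
  Assign rL (Plus (Reg rL) (Minus (Reg rU) (Reg rL))) ;;
  Assign rZ (Reg rE) ;; Assign rU (Reg rD) ;; readvars 9 ;;
  If (Plus (Minus (Reg rU) (Reg rY)) (Minus (Reg rY) (Reg rU))) Fail Skip ;;
  If (Reg rA) (Put NEED (Reg rX) 1 ;; Put HAVE (Reg rZ) 1) Skip.

Definition do_and : cmd :=
  Put STK (Reg rSP) (Reg rA) ;;
  Put STK (Plus (Reg rSP) 1) (Reg rA) ;;
  Assign rSP (Plus (Reg rSP) 2).

(** The flag of the first disjunct is pushed last, as it is popped first. On flags, truncated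
    [a - c] is [a && ~~ c], and [a - (a - c)] is [a && c]. *)
Definition do_or : cmd :=
  Guess rB ;;
  Put STK (Reg rSP) (Minus (Reg rA) (Reg rB)) ;;
  Put STK (Plus (Reg rSP) 1) (Minus (Reg rA) (Minus (Reg rA) (Reg rB))) ;;
  Assign rSP (Plus (Reg rSP) 2).

Definition do_pos : cmd :=
  Guess rB ;; readvar ;; If (Reg rA) (If (Reg rB) Skip Fail) Skip.

Definition do_neg : cmd :=
  Guess rB ;; readvar ;; If (Reg rA) (If (Reg rB) Fail Skip) Skip.

Definition item : cmd :=
  Assign rSP (Minus (Reg rSP) 1) ;;
  Assign rA (Get STK (Reg rSP)) ;;
  Assign rT (Get TOK (Reg rP)) ;;
  Assign rP (Plus (Reg rP) 1) ;;
  If (Reg rT)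
    (If (Minus (Reg rT) 1)
      (If (Minus (Reg rT) 2)
        (If (Minus (Reg rT) 3)
          (If (Minus (Reg rT) 4)
            (If (Minus (Reg rT) 5)
              (If (Minus (Reg rT) 6)
                (If (Minus (Reg rT) 7)
                  (If (Minus (Reg rT) 8) Fail do_or)
                  do_and)
                Fail)
              do_inc)
            do_neg)
          do_pos)
        (If (Reg rA) Fail Skip))
      Skip)
    Fail.

Definition items : cmd := While (Reg rSP) item.

Definition pass : cmd :=
  Assign rP 0 ;; Put STK 0 1 ;; Assign rSP 1 ;;
  items ;;
  If (Get TOK (Reg rP)) Fail Skip ;;
  Print 9.

(** The input can be read only once, while every pass needs the whole formula. [rP] ends as the
    length of the word. *)
Definition load : cmd :=
  Read rT ;;
  While (Reg rT)
    (Put TOK (Reg rP) (Reg rT) ;; Assign rP (Plus (Reg rP) 1) ;; Read rT).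

(* [rE] is positive as long as passes remain; as it is only needed between two
   passes, [do_inc] may overwrite it.  After the first pass [rL] holds
   [rD * 2 ^ k] for the arity [k], which bounds both the addresses used in
   [NEED] and [HAVE] and the number of passes. *)
Definition passes : cmd :=
  While (Reg rE) (pass ;; Assign rE (Minus (Reg rL) (Reg rI)) ;;
                  Assign rI (Plus (Reg rI) 1)).

Definition check : cmd :=
  While (Reg rL)
    (Assign rL (Minus (Reg rL) 1) ;;
     If (Get NEED (Reg rL)) (If (Get HAVE (Reg rL)) Skip Fail) Skip).

(** Stamps start at 1 because [CELL] is initially 0. The positions recorded at atoms are at most the
    length of the word, hence smaller than [rD]. *)
Definition sat_cmd : cmd :=
  load ;;
  Assign rD (Plus (Reg rP) 1) ;; Assign rL (Reg rD) ;; Assign rI 1 ;; Assign rE 1 ;;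
  passes ;; check.

Arguments aget _ _ /.

Ltac wp_step :=
  lazymatch goal with
  | |- wp (Seq _ _) _ _ => apply: wp_seq
  | |- wp Skip _ _ => apply: wp_skip
  | |- wp Fail _ _ => apply: wp_fail
  | |- wp (Assign _ _) _ _ => apply: wp_assign
  | |- wp (Put _ _ _) _ _ => apply: wp_put
  | |- wp (Guess _) _ _ => apply: wp_guess
  | |- wp (Read _) _ _ => apply: wp_read
  | |- wp (Print _) _ _ => apply: wp_print
  | |- wp (If _ _ _) _ _ => apply: wp_if
  end; rewrite /=.

Ltac wp_steps := rewrite /=; repeat wp_step.

(** * Reading variables *)

Fixpoint valb (bs : seq bool) : nat :=
  if bs is b :: bs' then b + (valb bs').*2 else 0.

Fixpoint vlits (xs : seq nat) (g : seq bool) : seq (nat * bool) :=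
  if xs is x :: xs' then (x, head false g) :: vlits xs' (behead g) else [::].

Definition coherent (s : seq (nat * bool)) : bool :=
  all (fun l => (l.1, ~~ l.2) \notin s) s.

Lemma coherent_rcons s x b : coherent s ->
  coherent (rcons s (x, b)) = ((x, ~~ b) \notin s).
Proof.
move=> h; rewrite /coherent all_rcons /= mem_rcons inE /= xpair_eqE eqxx /=.
have -> : (~~ b == b) = false by case: b.
case: (boolP (_ \in s)) => //= hn; apply/allP => -[y c] yc /=.
rewrite mem_rcons inE xpair_eqE negb_or (allP h _ yc) andbT.
by apply/andP => -[/eqP e /eqP ec]; move: hn; rewrite -ec -e negbK yc.
Qed.

Lemma coherent_catl s1 s2 : coherent (s1 ++ s2) -> coherent s1.
Proof.
move/allP=> h; apply/allP => l hl; have := h l; rewrite mem_cat hl => /(_ isT).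
by rewrite mem_cat negb_or => /andP [].
Qed.

(** The literal of [x] with sign [b] has the cell [2 * x + b]. The machine tests that a stamp is
    smaller than [i]; the bound by [i] makes this the same as being different from [i]. *)
Definition stamped (cell : nat -> nat) (i : nat) (s : seq (nat * bool)) : Prop :=
  forall x b, cell (x + x + nat_of_bool b) <= i /\
    (cell (x + x + nat_of_bool b) == i) = ((x, b) \in s).

Lemma stamped_rcons cell i s x b : stamped cell i s ->
  stamped (upd cell (x + x + nat_of_bool b) i) i (rcons s (x, b)).
Proof.
move=> h y c; rewrite mem_rcons inE xpair_eqE /upd.
have -> : (y + y + nat_of_bool c == x + x + nat_of_bool b) = (y == x) && (c == b).
  by case: b c => [] []; lia.
by case: ifP => _; [rewrite leqnn eqxx | exact: h].
Qed.

Definition tok (w : word) : nat -> nat := nth 0 (codes w).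

Lemma tokE w p u : drop p w = u -> tok w p = head 0 (codes u).
Proof. by move=> <-; rewrite /tok /codes map_drop -nth0 nth_drop addn0. Qed.

Lemma dropS (w : word) p : drop p.+1 w = behead (drop p w).
Proof. by rewrite -drop1 drop_drop add1n. Qed.

Lemma drop_cat_size (w u v : word) p : drop p w = u ++ v -> drop (p + size u) w = v.
Proof. by move=> e; rewrite addnC -drop_drop e drop_size_cat. Qed.

Lemma pos_bits_last (bs : seq bool) : last true bs -> bs <> [::] ->
  exists2 p, pos_bits p = bs & nat_of_bin (BinNums.Npos p) = valb bs.
Proof.
elim: bs => //= b bs IH; case: bs IH => [|c bs] IH /= hl _.
  by case: b hl => // _; exists BinNums.xH.
have [|//|p e v] := IH _; first by [].
exists (if b then BinNums.xI p else BinNums.xO p); first by case: b {hl}; rewrite /= e.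
rewrite -[_ + (valb bs).*2]/(valb (c :: bs)) -v /=.
by case: b {hl} => /=; rewrite !NatTrec.doubleE.
Qed.

(** [last true bs] excludes leading zeros and, through its default, admits the empty numeral of
    0. *)
Lemma nat_bits_valb bs : last true bs -> nat_bits (valb bs) = bs.
Proof.
case: (bs =P [::]) => [-> //|ne hl].
have [p <- /= <-] := pos_bits_last hl ne.
by rewrite /nat_bits -[nat_of_pos p]/(nat_of_bin (BinNums.Npos p)) nat_of_binK.
Qed.

Lemma nat_bits_last x : last true (nat_bits x).
Proof.
rewrite /nat_bits; case: bin_of_nat => //= p.
suff h c : last c (pos_bits p) by exact: h.
by elim: p c => //=.
Qed.

Lemma nat_bits_cancel x : valb (nat_bits x) = x.
Proof. by apply: nat_bits_inj; rewrite nat_bits_valb // nat_bits_last. Qed.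

Definition starts_bit (u : word) : bool := if u is SBit _ :: _ then true else false.

Lemma bits_prefix (u : word) :
  exists bs r, u = map SBit bs ++ r /\ ~~ starts_bit r.
Proof.
elim: u => [|s u [bs [r [-> h]]]]; first by exists [::], [::].
case: s; try by move: (map _ _ ++ _) => v; exists [::]; eexists; split; [reflexivity|].
by move=> b; exists (b :: bs), r.
Qed.

Lemma bits_prefix_inj bs bs' r r' : ~~ starts_bit r -> ~~ starts_bit r' ->
  map SBit bs ++ r = map SBit bs' ++ r' -> bs = bs' /\ r = r'.
Proof.
move=> h h'; elim: bs bs' => [|b bs IH] [|b' bs'] //=.
- by move=> e; rewrite e in h.
- by move=> e; rewrite -e in h'.
- by case=> -> /IH [-> ->].
Qed.

(** The loop looks one token ahead: [rT] holds the token at [p] while [rP] is already [p + 1]. *)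
Lemma readbits_spec w p bs r sp a b v wt q i L D x y z d e st inp o g tk
    (aa := [:: tok w & st]) :
  drop p w = map SBit bs ++ r -> ~~ starts_bit r ->
  wp readbits
    (State [:: p.+1; sp; a; tok w p; b; v; wt; nat_of_bool q; i; L; D; x; y; z; d; e]
       aa inp o g tk)
    (fun res => exists wt' tk', tk' <= tk + 8 * size bs + 1 /\
       res = Ok (State [:: (p + size bs).+1; sp; a; head 0 (codes r); b;
           v + wt * valb bs; wt'; nat_of_bool (last q bs); i; L; D; x; y; z; d; e]
         aa inp (o ++ codes (map SBit bs)) g tk')).
Proof.
move=> + hr; elim: bs p v wt q o tk => [|c bs IH] p v wt q o tk /= hd.
  apply: wp_while0 => /=.
    by rewrite (tokE hd); case: r hr {hd} => [|[] ] //.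
  by exists wt, tk.+1; rewrite (tokE hd) !muln0 !addn0 cats0 addn1.
have ht : tok w p = 11 + c by rewrite (tokE hd) /=; case: (c).
set K := fun res => _.
have hd1 : drop p.+1 w = map SBit bs ++ r by rewrite dropS hd.
have fin tk' : tk' <= tk + 8 -> wp readbits
  (State [:: p.+2; sp; a; tok w p.+1; b; v + c * wt; wt + wt; nat_of_bool c;
             i; L; D; x; y; z; d; e]
       aa inp (rcons o (tok w p)) g tk') K.
  move=> le; apply: wp_mono (IH _ _ _ _ _ _ hd1) _ => _ [wt' [tk2 [le' ->]]].
  exists wt', tk2; split; first lia.
  have -> : p + (size bs).+1 = p.+1 + size bs by lia.
  have -> : v + wt * (c + (valb bs).*2) = v + c * wt + (wt + wt) * valb bs.
    by case: (c); nia.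
  by rewrite cat_rcons ht; case: (c).
apply: wp_while1; first by rewrite /= ht.
move: K fin => K fin; do 4 wp_step.
have -> : tok w p - 11 = nat_of_bool c by rewrite ht addKn.
case: c ht fin {IH hd} => ht fin; wp_steps; rewrite !addn1.
  by move: (fin tk.+4.+4); rewrite /= mul1n; apply; lia.
by move: (fin tk.+3.+4); rewrite /= mul0n addn0; apply; lia.
Qed.

(** Failure means that every variable parsed at [p] contradicts an earlier literal. Malformed
    numerals fall under this vacuously, so one statement covers both causes; the later
    specifications have the same form. *)
Lemma readvar_spec w p u lits sp a t (b : bool) v wt q i L D x y z d e
    stk cell aa inp o g tk :
  drop p w = u -> stamped cell i lits ->
  wp readvar
    (State [:: p; sp; a; t; nat_of_bool b; v; wt; q; i; L; D; x; y; z; d; e]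
       [:: tok w, stk, cell & aa] inp o g tk)
    (fun res => match res with
     | Ok s => exists x0 u' t' v' w' q' cell' tk', [/\ u = enc_var x0 ++ u',
         (x0, ~~ b) \notin lits, stamped cell' i (rcons lits (x0, b)),
         tk' <= tk + 20 * size (enc_var x0) &
         s = State [:: p + size (enc_var x0); sp; a; t'; nat_of_bool b; v'; w'; q';
                       i; L; D; x; y; z; d; e]
              [:: tok w, stk, cell' & aa] inp (o ++ codes (enc_lit (x0, b))) g tk']
     | Ko t' => t' <= tk + 20 * (size u).+1 /\
         forall x0 u', u = enc_var x0 ++ u' -> (x0, ~~ b) \in lits
     end).
Proof.
move=> hd hc; have [bs [r [eu hr]]] := bits_prefix u.
have := hd; rewrite eu => hdr.
set K := fun res => _; rewrite /readvar; wp_steps; rewrite addn1.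
have su : size u = size bs + size r by rewrite eu size_cat size_map.
apply: wp_mono.
  by apply: (readbits_spec _ _ _ _ _ true) => //; [exact: hdr | exact: hr].
move=> _ [wt' [tk1 [le1 ->]]].
have key x0 u' : map SBit bs ++ r = enc_var x0 ++ u' ->
    bs = nat_bits x0 /\ r = SHash :: u'.
  by rewrite /enc_var cat_rcons; apply: bits_prefix_inj.
(* A missing hash and a leading zero are treated alike: in either case no variable can be parsed. *)
have bad t' : (forall u', r = SHash :: u' -> ~~ last true bs) ->
    t' <= tk1 + 9 -> K (Ko t').
  move=> hb le; split=> [|x0 u' /key [eb /hb]].
    by rewrite -eu; lia.
  by rewrite eb nat_bits_last.
rewrite /bind; wp_steps.
case: (boolP (head 0 (codes r) == 10)) => [/eqP er|nr]; last first.
  have -> : 10 - head 0 (codes r) = (9 - head 0 (codes r)).+1.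
    by case: (r) nr hr => // -[] // -[].
  wp_steps; apply: bad => [u' e'|]; last lia.
  by rewrite e' in nr.
have [r' {}er] : exists r', r = SHash :: r'.
  by case: (r) er => [|[||||||||||[]] r'] // _; exists r'.
rewrite er [codes _]/= [head _ _]/= subnn; wp_steps.
case: (boolP (last true bs)) => hl; wp_steps; last first.
  by apply: bad => //; lia.
rewrite add0n mul1n; set x0 := valb bs.
have sb : 1 - nat_of_bool b = nat_of_bool (~~ b) by case: (b).
rewrite sb; have [le eq] := hc x0 (~~ b).
have ex : enc_var x0 = rcons (map SBit bs) SHash by rewrite /enc_var nat_bits_valb.
have sx : size (enc_var x0) = (size bs).+1 by rewrite ex size_rcons size_map.
case: ltngtP le eq => [lt _ /esym nin|//|-> _ /esym isin]; last first.
  rewrite subnn; wp_steps.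
  split; first by rewrite size_cat size_map /=; lia.
  move=> x1 u' /key [eb _].
  by rewrite -(nat_bits_cancel x1) -eb.
rewrite -(prednK (n := i - _)) ?subn_gt0 //; wp_steps.
exists x0, r'; do 6 eexists; split; last first.
- rewrite sx addnS.
  have -> : rcons (rcons o (4 - b) ++ codes [seq SBit i | i <- bs]) 10 =
      o ++ codes (enc_lit (x0, b)).
    rewrite /enc_lit ex /codes /= map_rcons rcons_cat cat_rcons /=.
    by case: (b).
  reflexivity.
- by rewrite sx; lia.
- exact: (stamped_rcons x0 b hc).
- by rewrite nin.
- by rewrite ex cat_rcons er.
Qed.

Lemma size_enc_vars_cons x xs :
  size (enc_vars (x :: xs)) = size (enc_var x) + size (enc_vars xs).
Proof. exact: size_cat. Qed.

(** Induction on the unread input, as the length of the tuple is known only when [a] is met. Since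
    [a] is neither a digit nor a hash, there is at most one way to parse the tuple. *)
Lemma readvars_spec w a u p lits sp ra t rb v wt q i L D rx ry z d f
    stk cell aa inp o g tk :
  a = SSub \/ a = SEnd -> drop p w = u -> stamped cell i lits -> coherent lits ->
  wp (readvars (code a))
    (State [:: p; sp; ra; t; rb; v; wt; q; i; L; D; rx; ry; z; d; f]
       [:: tok w, stk, cell & aa] inp o g tk)
    (fun res => match res with
     | Ok s => exists xs u' t' b' v' w' q' cell' tk',
         [/\ u = enc_vars xs ++ a :: u',
             coherent (lits ++ vlits xs g), stamped cell' i (lits ++ vlits xs g),
             tk' <= tk + 30 * (size (enc_vars xs)).+1 &
         s = State [:: p + (size (enc_vars xs)).+1; sp; ra; t'; b'; v'; w'; q';
                       i; L; D; rx; ry; z + d * valb (map snd (vlits xs g));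
                       d * 2 ^ size xs; f]
              [:: tok w, stk, cell' & aa] inp
              (o ++ codes (flatten (map enc_lit (vlits xs g))))
              (drop (size xs) g) tk']
     | Ko t' => t' <= tk + 30 * (size u).+1 /\
         forall xs u', u = enc_vars xs ++ a :: u' ->
         ~~ coherent (lits ++ vlits xs g)
     end).
Proof.
move=> ha; have [n] := ubnP (size u).
elim: n u p lits t rb v wt q z d cell o g tk => // n IH.
move=> u p lits t rb v wt q z d cell o g tk su hd hc hl.
set K := fun res => _; rewrite /readvars; wp_step.
have ab c : a <> SBit c by case: ha => ->.
have aH : a <> SHash by case: ha => ->.
have [[u' eu]|nu] : (exists u', u = a :: u') \/
    head 0 (codes u) - code a + (code a - head 0 (codes u)) > 0.
- case: (u) => [|s u']; first by right; case: ha => ->.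
  case: (boolP (code s == code a)) => e; last by right => /=; lia.
  left; exists u'; congr (_ :: _).
  by case: ha e => -> ; case: s => // -[].
- apply: wp_while0; first by rewrite /= (tokE hd) eu /= subnn.
  rewrite /=; wp_steps; exists [::], u'; do 7 eexists; split; last first.
  + rewrite /= cats0 drop0 muln0 addn0 muln1; reflexivity.
  + by rewrite /=; lia.
  + by rewrite cats0.
  + by rewrite cats0.
  + by rewrite eu.
have nnil xs u' : u = enc_vars xs ++ a :: u' -> exists x xs', xs = x :: xs'.
  case: xs => [e|x xs _]; last by exists x, xs.
  by rewrite e /= subnn in nu.
apply: wp_while1; first by rewrite /= (tokE hd).
rewrite /=; wp_steps.
apply: wp_mono.
  by apply: readvar_spec; [exact: hd | exact: hc].
case=> [s|t'] /=; last first.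
  move=> [le h]; split; first lia.
  move=> xs u' e; have [x [xs' ex]] := nnil _ _ e; subst xs.
  rewrite e /enc_vars /= -catA in h; have := h _ _ erefl.
  rewrite /= -cat_rcons => h1; apply/negP => /coherent_catl.
  by rewrite coherent_rcons // h1.
case=> x [u1 [t1 [v1 [w1 [q1 [cell1 [tk1 [eu nin hc1 le1 ->]]]]]]]].
have := hd; rewrite {1}eu => hd'; have sx : 0 < size (enc_var x) by rewrite size_rcons.
have hd1 := drop_cat_size hd'.
have su' : size u = size (enc_var x) + size u1 by rewrite eu size_cat.
set bb := head false g in nin hc1 *; set g1 := behead g.
have hl1 : coherent (rcons lits (x, bb)) by rewrite coherent_rcons.
have eg xs : lits ++ vlits (x :: xs) g = rcons lits (x, bb) ++ vlits xs g1.
  by rewrite cat_rcons.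
have su1 : size u1 < n by lia.
(* The remaining turns, for either value of the guessed bit: it decides whether [d] is added to [z],
   and [d] is doubled in any case. *)
have fin tk' : tk' <= tk1 + 4 ->
  wp (readvars (code a))
    (State [:: p + size (enc_var x); sp; ra; t1; nat_of_bool bb; v1; w1; q1; i; L; D;
               rx; ry; z + bb * d; d + d; f]
       [:: tok w, stk, cell1 & aa] inp (o ++ codes (enc_lit (x, bb))) g1 tk') K.
  move=> le; apply: wp_mono; first exact: IH su1 hd1 hc1 hl1.
  case=> [s'|t'] /=; last first.
    case=> le' h; split; first by lia.
    move=> xs u' e; have [x2 [xs' exs]] := nnil _ _ e; subst xs.
    move: e; rewrite eu /enc_vars /= -catA => /enc_var_cat [<- /h].
    by rewrite eg.
  case=> xs [u' [t2 [b2 [v2 [w2 [q2 [cell2 [tk2 [eu1 hl2 hc2 le2 ->]]]]]]]]].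
  exists (x :: xs), u'; do 7 eexists; split; last first.
  - have -> : p + (size (enc_vars (x :: xs))).+1 =
      p + size (enc_var x) + (size (enc_vars xs)).+1 by rewrite size_enc_vars_cons; lia.
    have -> : z + d * valb [seq i.2 | i <- vlits (x :: xs) g] =
      z + bb * d + (d + d) * valb [seq i.2 | i <- vlits xs g1].
      by rewrite /= -/bb -/g1; nia.
    have -> : d * 2 ^ size (x :: xs) = (d + d) * 2 ^ size xs.
      by rewrite expnS mulnA muln2 addnn.
    have -> : drop (size (x :: xs)) g = drop (size xs) g1.
      by rewrite /g1 -drop1 drop_drop addn1.
    have -> : o ++ codes (flatten (map enc_lit (vlits (x :: xs) g))) =
      (o ++ codes (enc_lit (x, bb))) ++ codes (flatten (map enc_lit (vlits xs g1))).
      by rewrite -catA /codes -map_cat.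
    by [].
  - by rewrite size_enc_vars_cons; lia.
  - by rewrite eg.
  - by rewrite eg.
  - by rewrite eu eu1 /enc_vars /= -catA.
move: K fin => K fin; case: bb fin {nin hc1 hl1 eg} => fin; wp_steps.
  move: (fin tk1.+3); rewrite /= mul1n => h.
  by apply: wp_seq_inv; apply: h; lia.
move: (fin tk1.+2); rewrite /= mul0n addn0 => h.
by apply: wp_seq_inv; apply: h; lia.
Qed.

(** * Reading formulas *)

Fixpoint guesses (phi : formula) : nat :=
  match phi with
  | PTop | PBot => 0
  | PPos _ | PNeg _ => 1
  | PInc n _ _ => n + n
  | PAnd f1 f2 => guesses f1 + guesses f2
  | POr f1 f2 => (guesses f1 + guesses f2).+1
  end.

(** [g] is consumed in the order in which the machine guesses, and missing bits count as [false], as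
    they do for the machine. *)
Fixpoint lits (phi : formula) (g : seq bool) : seq (nat * bool) :=
  match phi with
  | PTop | PBot => [::]
  | PPos x | PNeg x => [:: (x, head false g)]
  | PInc n xs ys => vlits xs g ++ vlits ys (drop n g)
  | PAnd f1 f2 => lits f1 g ++ lits f2 (drop (guesses f1) g)
  | POr f1 f2 => lits f1 (behead g) ++ lits f2 (drop (guesses f1) (behead g))
  end.

(* [a] tells whether the assignment belongs to the subteam for [phi]; at a
   disjunction the first guess sends it to one of the two disjuncts. *)
Fixpoint valid (phi : formula) (a : bool) (g : seq bool) : bool :=
  match phi with
  | PTop | PInc _ _ _ => true
  | PBot => ~~ a
  | PPos _ => a ==> head false g
  | PNeg _ => a ==> ~~ head false g
  | PAnd f1 f2 => valid f1 a g && valid f2 a (drop (guesses f1) g)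
  | POr f1 f2 =>
      let c := head false g in
      valid f1 (a && c) (behead g) &&
      valid f2 (a && ~~ c) (drop (guesses f1) (behead g))
  end.

(* The patterns that an assignment needs ([h = false]) or provides
   ([h = true]) at the inclusion atoms of [phi], which are identified by their
   positions, [p] being that of [phi]. *)
Fixpoint keys (h : bool) (phi : formula) (p : nat) (a : bool) (g : seq bool) :
    seq (nat * seq bool) :=
  match phi with
  | PInc n xs ys =>
      if a then
        [:: (p.+1, map snd (if h then vlits ys (drop n g) else vlits xs g))]
      else [::]
  | PAnd f1 f2 =>
      keys h f1 p.+1 a g ++
      keys h f2 (p.+1 + size (enc f1)) a (drop (guesses f1) g)
  | POr f1 f2 =>
      let c := head false g in
      keys h f1 p.+1 (a && c) (behead g) ++
      keys h f2 (p.+1 + size (enc f1)) (a && ~~ c)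
        (drop (guesses f1) (behead g))
  | _ => [::]
  end.

Definition address (D : nat) (k : nat * seq bool) : nat := k.1 + D * valb k.2.

(** In the middle of a pass the unread input should be a forest, one formula for each flag on the
    stack. The functions prefixed by [f] extend those on formulas to forests. *)
Definition encs (fs : seq formula) : word := flatten (map enc fs).

Definition fguesses (fs : seq formula) : nat := sumn (map guesses fs).

Definition farity (fs : seq formula) : nat := foldr maxn 0 (map arity fs).

Fixpoint flits (fs : seq formula) (g : seq bool) : seq (nat * bool) :=
  if fs is f :: fs' then lits f g ++ flits fs' (drop (guesses f) g) else [::].

Fixpoint fvalid (fs : seq formula) (st g : seq bool) : bool :=
  if fs is f :: fs' then
    valid f (head false st) g && fvalid fs' (behead st) (drop (guesses f) g)
  else true.

Fixpoint fkeys (h : bool) (fs : seq formula) (p : nat) (st g : seq bool) :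
    seq (nat * seq bool) :=
  if fs is f :: fs' then
    keys h f p (head false st) g ++
    fkeys h fs' (p + size (enc f)) (behead st) (drop (guesses f) g)
  else [::].

(** The head of [st] is the top of the stack; cells from its height on are arbitrary. *)
Definition stacked (stk : nat -> nat) (st : seq bool) : Prop :=
  forall j, j < size st -> stk j = nat_of_bool (nth false (rev st) j).

Lemma stacked_behead stk a st : stacked stk (a :: st) ->
  stk (size st) = nat_of_bool a /\ stacked stk st.
Proof.
move=> h; split; first by rewrite h //= rev_cons nth_rcons size_rev ltnn eqxx.
move=> j lt; rewrite h; last by apply: ltnW.
by rewrite rev_cons nth_rcons size_rev lt.
Qed.

Lemma stacked_cons stk a st :
  stacked stk st -> stacked (upd stk (size st) (nat_of_bool a)) (a :: st).
Proof.
move=> h j /=; rewrite ltnS leq_eqVlt rev_cons nth_rcons size_rev /upd.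
by case: eqP => [->|_ /=] // lt; rewrite ?ltnn // lt h.
Qed.

Definition ind (s : seq nat) : nat -> nat := fun k => nat_of_bool (k \in s).

Lemma upd_ind s k : upd (ind s) k 1 = ind (s ++ [:: k]).
Proof.
apply/funext => j; rewrite /upd /ind mem_cat inE.
by case: eqP => _; rewrite ?orbT ?orbF.
Qed.

Lemma muln_exp2_max D m n : D * 2 ^ maxn m n = maxn (D * 2 ^ m) (D * 2 ^ n).
Proof.
rewrite -maxnMr; congr (_ * _); case: (ltnP m n) => h.
  by rewrite (maxn_idPr _) // leq_exp2l // ltnW.
by rewrite (maxn_idPl _) // leq_exp2l.
Qed.

(** Only the registers among the arguments carry information from one item to the next; the others
    are existentially quantified. *)
Definition shape w p sp i L D stk cell N H u o g tk (s : state) : Prop :=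
  exists ra t rb v wt, exists q rx ry z d, exists f,
  s = State [:: p; sp; ra; t; rb; v; wt; q; i; L; D; rx; ry; z; d; f]
        [:: tok w; stk; cell; ind N; ind H] u o g tk.

Definition items_post w u p l0 st N H i L D inp o g tk (r : res) : Prop :=
  match r with
  | Ok s => exists fs u' stk cell tk',
      [/\ [/\ size fs = size st, u = encs fs ++ u',
              coherent (l0 ++ flits fs g) & fvalid fs st g],
          stamped cell i (l0 ++ flits fs g),
          tk' <= tk + 100 * size (encs fs) + 1 &
          shape w (p + size (encs fs)) 0 i (maxn L (D * 2 ^ farity fs)) D
            stk cell (N ++ map (address D) (fkeys false fs p st g))
            (H ++ map (address D) (fkeys true fs p st g)) inp
            (o ++ codes (flatten (map enc_lit (flits fs g))))
            (drop (fguesses fs) g) tk' s]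
  | Ko t => t <= tk + 100 * (size u).+1 /\
      forall fs u', size fs = size st -> u = encs fs ++ u' ->
        ~~ (coherent (l0 ++ flits fs g) && fvalid fs st g)
  end.

Ltac wp_calc := rewrite /=; repeat (wp_step; rewrite ?subSS ?subn0 /=).

Section ItemsStep.

Variables (w u : word) (p : nat) (l0 : seq (nat * bool)) (st : seq bool).
Variables (N H : seq nat) (i L D : nat) (inp o : seq nat) (g : seq bool) (tk : nat).
Variables (tks u1 : word) (st1 : seq bool) (nl : seq (nat * bool)).
Variables (nk hk : seq (nat * seq bool)) (L1 : nat) (g1 : seq bool) (tk1 : nat).
Variable (F : seq formula -> seq formula).

Hypothesis eu : u = tks ++ u1.
Hypothesis tks_gt0 : 0 < size tks.
Hypothesis tk1_le : tk1 <= tk + 100 * size tks.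
Hypothesis FP : forall fs, size fs = size st1 ->
  [/\ [/\ size (F fs) = size st, encs (F fs) = tks ++ encs fs,
      flits (F fs) g = nl ++ flits fs g1 & fvalid (F fs) st g = fvalid fs st1 g1],
      fkeys false (F fs) p st g = nk ++ fkeys false fs (p + size tks) st1 g1,
      fkeys true (F fs) p st g = hk ++ fkeys true fs (p + size tks) st1 g1,
      maxn L (D * 2 ^ farity (F fs)) = maxn L1 (D * 2 ^ farity fs) &
      drop (fguesses (F fs)) g = drop (fguesses fs) g1].
Hypothesis FK : forall fs u', size fs = size st -> u = encs fs ++ u' ->
  exists2 fs1, size fs1 = size st1 & fs = F fs1.

(** One turn consumes [tks] and turns the stack [st] into [st1]. [F] recovers the forest before the
    turn from the one after it, by adding a leaf or by joining two formulas with a connective; [FK]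
    says that all parses of [u] arise so, which transfers failure. *)
Lemma items_post_step r :
  items_post w u1 (p + size tks) (l0 ++ nl) st1 (N ++ map (address D) nk)
    (H ++ map (address D) hk) i L1 D inp
    (o ++ codes (flatten (map enc_lit nl))) g1 tk1 r ->
  items_post w u p l0 st N H i L D inp o g tk r.
Proof.
case: r => [s|t] /=; last first.
  case=> le h; split; first by rewrite eu size_cat; lia.
  move=> fs u' sz e; have [fs1 sz1 efs] := FK sz e; subst fs.
  have [[_ ee el ev] _ _ _ _] := FP sz1.
  rewrite el ev catA; apply: (h _ u') => //.
  move: e; rewrite eu ee -catA => /(congr1 (drop (size tks))).
  by rewrite !drop_size_cat.
case=> fs [u' [stk [cell [tk' [[sz e hc hv] hs le sh]]]]].
have [[szF ee el ev] ek eh eL eg] := FP sz.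
exists (F fs), u', stk, cell, tk'; split.
- by rewrite szF ee el ev catA; split; rewrite // eu e catA.
- by rewrite el catA.
- by rewrite ee size_cat; lia.
- rewrite ee el ek eh eL eg size_cat addnA !map_cat /= flatten_cat /codes.
  by rewrite map_cat !catA.
Qed.

End ItemsStep.

Lemma wp_readvar w p u l0 sp a t (b : bool) v wt q i L D x y z d e
    stk cell aa inp o g tk K :
  drop p w = u -> stamped cell i l0 -> coherent l0 ->
  (forall t', t' <= tk + 20 * (size u).+1 ->
     (forall x0 u', u = enc_var x0 ++ u' -> ~~ coherent (l0 ++ [:: (x0, b)])) ->
     K (Ko t')) ->
  (forall x0 u' t' v' w' q' cell' tk', u = enc_var x0 ++ u' ->
     coherent (l0 ++ [:: (x0, b)]) -> stamped cell' i (l0 ++ [:: (x0, b)]) ->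
     tk' <= tk + 20 * size (enc_var x0) ->
     K (Ok (State [:: p + size (enc_var x0); sp; a; t'; nat_of_bool b; v'; w'; q';
                      i; L; D; x; y; z; d; e]
              [:: tok w, stk, cell' & aa] inp (o ++ codes (enc_lit (x0, b))) g tk'))) ->
  wp readvar
    (State [:: p; sp; a; t; nat_of_bool b; v; wt; q; i; L; D; x; y; z; d; e]
       [:: tok w, stk, cell & aa] inp o g tk) K.
Proof.
move=> hd hc hl h1 h2; apply: wp_mono.
  by apply: readvar_spec; [exact: hd | exact: hc].
case=> [s [x0 [u' [t' [v' [w' [q' [cell' [tk' [eu nin hc' le ->]]]]]]]]]|t' [le h]].
  by apply: (h2 _ u'); rewrite ?cats1 // coherent_rcons.
apply: h1 => // x0 u' eu; rewrite cats1 coherent_rcons // negbK.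
exact: h eu.
Qed.

Lemma enc_inc_cat n (xs ys : n.-tuple nat) v : enc (PInc xs ys) ++ v =
  SInc :: (enc_vars xs ++ SSub :: (enc_vars ys ++ SEnd :: v)).
Proof. by rewrite /= -catA /= -catA. Qed.

Lemma wp_readvars w a u p l0 sp ra t rb v wt q i L D x y z d e
    stk cell aa inp o g tk K :
  a = SSub \/ a = SEnd -> drop p w = u -> stamped cell i l0 -> coherent l0 ->
  (forall t', t' <= tk + 30 * (size u).+1 ->
     (forall xs u', u = enc_vars xs ++ a :: u' -> ~~ coherent (l0 ++ vlits xs g)) ->
     K (Ko t')) ->
  (forall xs u' t' b' v' w' q' cell' tk', u = enc_vars xs ++ a :: u' ->
     coherent (l0 ++ vlits xs g) -> stamped cell' i (l0 ++ vlits xs g) ->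
     tk' <= tk + 30 * (size (enc_vars xs)).+1 ->
     K (Ok (State [:: p + (size (enc_vars xs)).+1; sp; ra; t'; b'; v'; w'; q';
                      i; L; D; x; y; z + d * valb (map snd (vlits xs g));
                      d * 2 ^ size xs; e]
              [:: tok w, stk, cell' & aa] inp
              (o ++ codes (flatten (map enc_lit (vlits xs g))))
              (drop (size xs) g) tk'))) ->
  wp (readvars (code a))
    (State [:: p; sp; ra; t; rb; v; wt; q; i; L; D; x; y; z; d; e]
       [:: tok w, stk, cell & aa] inp o g tk) K.
Proof.
move=> ha hd hc hl h1 h2; apply: wp_mono.
  by apply: readvars_spec; [exact: ha | exact: hd | exact: hc | exact: hl].
case=> [s|t' [le h]]; last exact: h1.
case=> xs [u' [t' [b' [v' [w' [q' [cell' [tk' [eu hl' hc' le ->]]]]]]]]].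
exact: (h2 xs u').
Qed.

(** Induction on the length of the unread input, with an arbitrary stack: this needs no formula in
    advance and treats a connective as one more item. *)
Lemma items_spec w u p l0 st N H i L D inp o g tk stk cell s :
  drop p w = u -> size w < D -> D <= L -> stamped cell i l0 -> coherent l0 ->
  stacked stk st -> shape w p (size st) i L D stk cell N H inp o g tk s ->
  wp items s (items_post w u p l0 st N H i L D inp o g tk).
Proof.
move=> + hD; have [n] := ubnP (size u).
elim: n u p l0 st N H L o g tk stk cell s => // n IH.
move=> u p l0 st N H L o g tk stk cell s su hd hL hs hc hst.
set K := items_post _ _ _ _ _ _ _ _ _ _ _ _ _ _.
case=> ra [t [rb [v [wt [q [rx [ry [z [d [f ->]]]]]]]]]].
case: st hst @K => [|a st] hst K.
  apply: wp_while0 => //; exists [::], u, stk, cell, tk.+1; split.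
  - by rewrite /= cats0.
  - by rewrite /= cats0.
  - by rewrite /=; lia.
  - rewrite /= !addn0 !cats0 muln1 drop0 (maxn_idPl hL).
    by do 11 eexists.
have [ea hst'] := stacked_behead hst.
have fin tks u1 st1 nl nk hk L1 g1 F stk1 cell1 s1 :
    u = tks ++ u1 -> 0 < size tks -> tick s1 <= tk + 100 * size tks ->
    (forall fs, size fs = size st1 ->
      [/\ [/\ size (F fs) = (size st).+1, encs (F fs) = tks ++ encs fs,
          flits (F fs) g = nl ++ flits fs g1 &
          fvalid (F fs) (a :: st) g = fvalid fs st1 g1],
          fkeys false (F fs) p (a :: st) g = nk ++ fkeys false fs (p + size tks) st1 g1,
          fkeys true (F fs) p (a :: st) g = hk ++ fkeys true fs (p + size tks) st1 g1,
          maxn L (D * 2 ^ farity (F fs)) = maxn L1 (D * 2 ^ farity fs) &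
          drop (fguesses (F fs)) g = drop (fguesses fs) g1]) ->
    (forall fs u', size fs = (size st).+1 -> u = encs fs ++ u' ->
      exists2 fs1, size fs1 = size st1 & fs = F fs1) ->
    D <= L1 -> stamped cell1 i (l0 ++ nl) -> coherent (l0 ++ nl) ->
    stacked stk1 st1 ->
    shape w (p + size tks) (size st1) i L1 D stk1 cell1
      (N ++ map (address D) nk) (H ++ map (address D) hk) inp
      (o ++ codes (flatten (map enc_lit nl))) g1 (tick s1) s1 ->
    wp items s1 K.
  move=> eu gt0 le FP FK hL1 hs1 hc1 hst1 sh.
  have hd1 : drop (p + size tks) w = u1 by apply: drop_cat_size; rewrite -eu.
  have su1 : size u1 < n by move: su; rewrite eu size_cat; lia.
  apply: wp_mono (IH _ _ _ _ _ _ _ _ _ _ _ _ _ su1 hd1 hL1 hs1 hc1 hst1 sh) _.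
  by move=> r; apply: (items_post_step (F := F) (st := a :: st) eu gt0 le FP FK).
(* The first formula of any forest starts at the current token, so refuting it refutes the
   forest. *)
have bad t' : t' <= tk + 100 * (size u).+1 ->
    (forall f fs u', size fs = size st -> u = enc f ++ encs fs ++ u' ->
      ~~ (coherent (l0 ++ lits f g) && valid f a g)) -> K (Ko t').
  move=> le h; split=> // -[|f1 fs] u' //= [sz]; rewrite /encs /= -catA => e.
  have := h _ _ _ sz e; apply: contra => /andP [].
  by rewrite catA => /coherent_catl -> /andP [-> _].
apply: wp_while1 => //; rewrite /item; wp_calc.
rewrite ea (tokE hd) addn1.
have hd1 : drop p.+1 w = behead u by rewrite dropS hd.
move: (K) fin bad => {}K fin bad.
case: u su hd hd1 fin bad => [|c u] su hd hd1 fin bad; wp_calc.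
  by apply: bad => [|[]] //=; lia.
case: c su hd hd1 fin bad => [||||||||||cb] su hd hd1 fin bad; wp_calc.
- apply: (fin [:: STop] u st [::] [::] [::] L g (cons PTop) stk cell) => //.
  + by rewrite /=; lia.
  + by move=> fs sz; rewrite /farity /= max0n sz addn1 drop0.
  + by case=> [|[] fs] //= u' [sz] _; exists fs.
  + by rewrite cats0.
  + by rewrite cats0.
  + by rewrite /= !cats0 addn1; do 11 eexists.
- case: a hst ea fin bad => hst ea fin bad; wp_calc.
    by apply: bad => [|[] //= *]; rewrite /= ?andbF //; lia.
  apply: (fin [:: SBot] u st [::] [::] [::] L g (cons PBot) stk cell) => //.
  + by rewrite /=; lia.
  + by move=> fs sz; rewrite /farity /= max0n sz addn1 drop0.
  + by case=> [|[] fs] //= u' [sz] _; exists fs.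
  + by rewrite cats0.
  + by rewrite cats0.
  + by rewrite /= !cats0 addn1; do 11 eexists.
- rewrite {1}/do_pos; wp_calc.
  apply: wp_readvar; [exact: hd1 | exact: hs | exact: hc | move=> t' le h | ].
    apply: bad => [|[] // x fs u' _ /= [e]]; first by rewrite /= in le *; lia.
    by apply: contra (h x _ e) => /andP [].
  move=> x u1 t1 v1 w1 q1 cell1 tk1 /= eu hc1 hs1 le.
  have sx : 0 < size (enc_var x) by rewrite size_rcons.
  have su1 : size u = size (enc_var x) + size u1 by rewrite eu size_cat.
  have hfin s1 : valid (PPos x) a g -> tick s1 <= tk1 + 5 ->
      shape w (p.+1 + size (enc_var x)) (size st) i L D stk cell1 N H inp
        (o ++ codes (enc_lit (x, head false g))) (behead g) (tick s1) s1 ->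
      wp items s1 K.
    move=> hv les sh; apply: (fin (SPos :: enc_var x) u1 st [:: (x, head false g)]
      [::] [::] L (behead g) (cons (PPos x)) stk cell1) => //.
    + by rewrite eu.
    + by rewrite /=; lia.
    + move=> fs sz; rewrite /farity /fguesses /= max0n sz drop1; split=> //.
        by split=> //; move: hv => /= ->.
      by rewrite -drop1 drop_drop addnC.
    + case=> [|[] f1] //= fs u' [sz] [e]; exists fs => //.
      by move: e; rewrite eu /encs /= -catA => /enc_var_cat [->].
    + by rewrite /= !cats0 addnS -addSn.
  have hbad t' : ~~ valid (PPos x) a g -> t' <= tk1 + 5 -> K (Ko t').
    move=> hv let'; apply: bad => [|[] // x2 fs u' _ /= [e]]; first by rewrite /=; lia.
    move: e; rewrite eu => /enc_var_cat [<- _].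
    by rewrite negb_and hv orbT.
  case: a {hst ea fin bad} hfin hbad => hfin hbad; wp_calc.
    case eb: (head false g) hfin hbad => hfin hbad; wp_calc.
      apply: hfin => //=; first by lia.
      by do 11 eexists.
    by apply: hbad; rewrite /= ?eb //; lia.
  apply: hfin => //=; first by lia.
  by do 11 eexists.
- rewrite {1}/do_neg; wp_calc.
  apply: wp_readvar; [exact: hd1 | exact: hs | exact: hc | move=> t' le h | ].
    apply: bad => [|[] // x fs u' _ /= [e]]; first by rewrite /= in le *; lia.
    by apply: contra (h x _ e) => /andP [].
  move=> x u1 t1 v1 w1 q1 cell1 tk1 /= eu hc1 hs1 le.
  have sx : 0 < size (enc_var x) by rewrite size_rcons.
  have su1 : size u = size (enc_var x) + size u1 by rewrite eu size_cat.
  have hfin s1 : valid (PNeg x) a g -> tick s1 <= tk1 + 5 ->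
      shape w (p.+1 + size (enc_var x)) (size st) i L D stk cell1 N H inp
        (o ++ codes (enc_lit (x, head false g))) (behead g) (tick s1) s1 ->
      wp items s1 K.
    move=> hv les sh; apply: (fin (SNeg :: enc_var x) u1 st [:: (x, head false g)]
      [::] [::] L (behead g) (cons (PNeg x)) stk cell1) => //.
    + by rewrite eu.
    + by rewrite /=; lia.
    + move=> fs sz; rewrite /farity /fguesses /= max0n sz drop1; split=> //.
        by split=> //; move: hv => /= ->.
      by rewrite -drop1 drop_drop addnC.
    + case=> [|[] f1] //= fs u' [sz] [e]; exists fs => //.
      by move: e; rewrite eu /encs /= -catA => /enc_var_cat [->].
    + by rewrite /= !cats0 addnS -addSn.
  have hbad t' : ~~ valid (PNeg x) a g -> t' <= tk1 + 5 -> K (Ko t').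
    move=> hv let'; apply: bad => [|[] // x2 fs u' _ /= [e]]; first by rewrite /=; lia.
    move: e; rewrite eu => /enc_var_cat [<- _].
    by rewrite negb_and hv orbT.
  case: a {hst ea fin bad} hfin hbad => hfin hbad; wp_calc.
    case eb: (head false g) hfin hbad => hfin hbad; wp_calc.
      by apply: hbad; rewrite /= ?eb //; lia.
    apply: hfin => //=; first by rewrite eb.
      by lia.
    by do 11 eexists.
  apply: hfin => //=; first by lia.
  by do 11 eexists.
- rewrite {1}/do_inc; wp_calc.
  apply: (@wp_readvars w SSub);
    [by left | exact: hd1 | exact: hs | exact: hc | move=> t' le h | ].
    apply: bad => [|[] // m xs ys fs u' _]; first by rewrite /= in le *; lia.
    rewrite enc_inc_cat => -[/h]; apply: contra => /andP [].
    by rewrite catA => /coherent_catl.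
  move=> xs u1 t1 b1 v1 w1 q1 cell1 tk1 /= eu hc1 hs1 le.
  have hd2 := hd1; rewrite /= eu -cat_rcons in hd2; have {}hd2 := drop_cat_size hd2.
  rewrite size_rcons in hd2; wp_calc.
  have su1 : size u = size (enc_vars xs) + (size u1).+1 by rewrite eu size_cat.
  apply: (@wp_readvars w SEnd);
    [by right | exact: hd2 | exact: hs1 | exact: hc1 | move=> t' le' h | ].
    apply: bad => [|[] // m xs' ys fs u' _]; first by rewrite /= in le' *; lia.
    rewrite enc_inc_cat => -[]; rewrite eu => /(@enc_vars_cat SSub) [] // exs.
    move=> /h; apply: contra => /andP [].
    by rewrite exs size_tuple -catA.
  move=> ys u2 t2 b2 v2 w2 q2 cell2 tk2 /= eu1 hc2 hs2 le2; wp_calc.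
  have su2 : size u1 = size (enc_vars ys) + (size u2).+1 by rewrite eu1 size_cat.
  have key m (xs' ys' : m.-tuple nat) fs u' :
      SInc :: u = enc (PInc xs' ys') ++ encs fs ++ u' ->
      [/\ xs = xs', ys = ys' & u2 = encs fs ++ u'].
    rewrite enc_inc_cat => -[]; rewrite eu => /(@enc_vars_cat SSub) [] // exs.
    by rewrite eu1 => /(@enc_vars_cat SEnd) [] // -> ->; rewrite exs.
  case: (eqVneq (size ys) (size xs)) => sz; last first.
    have ne : D * 2 ^ size ys != D * 2 ^ size xs.
      by rewrite eqn_pmul2l ?eqn_exp2l //; lia.
    (* The absolute difference is positive; written as a successor it makes the test reduce to
       failure. *)
    have [m ->] : exists m, D * 2 ^ size ys - D * 2 ^ size xs +
        (D * 2 ^ size xs - D * 2 ^ size ys) = m.+1.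
      by exists (D * 2 ^ size ys - D * 2 ^ size xs +
        (D * 2 ^ size xs - D * 2 ^ size ys)).-1; lia.
    wp_calc; apply: bad => [|[] // m' xs' ys' fs u' _ /key [ex ey _]].
      by rewrite /=; lia.
    by move: sz; rewrite ex ey !size_tuple eqxx.
  rewrite sz subnn; wp_calc.
  pose phi := PInc (in_tuple xs) (Tuple (introT eqP sz)).
  have eu2 : SInc :: u = enc phi ++ u2 by rewrite enc_inc_cat eu eu1.
  have szp : size (enc phi) = (size (enc_vars xs)).+1 + (size (enc_vars ys)).+1 + 1.
    by rewrite /= size_cat /= size_cat /=; lia.
  have hfin s1 NN HH :
      NN = map (address D) (keys false phi p a g) ->
      HH = map (address D) (keys true phi p a g) ->
      tick s1 <= tk2 + 10 ->
      shape w (p + size (enc phi)) (size st) i (L + (D * 2 ^ size xs - L)) D stk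
        cell2 (N ++ NN) (H ++ HH) inp
        ((o ++ codes (flatten (map enc_lit (vlits xs g)))) ++
         codes (flatten (map enc_lit (vlits ys (drop (size xs) g)))))
        (drop (size ys) (drop (size xs) g)) (tick s1) s1 ->
      wp items s1 K.
    move=> -> -> les sh; apply: (fin (enc phi) u2 st (lits phi g)
      (keys false phi p a g) (keys true phi p a g)
      (L + (D * 2 ^ size xs - L)) (drop (guesses phi) g) (cons phi) stk cell2).
    + by [].
    + by rewrite szp addn1.
    + by rewrite szp; lia.
    + move=> fs szf; rewrite -maxnE /farity [map _ _]/= [foldr _ _ _]/=.
      rewrite muln_exp2_max maxnA; split=> //.
        by split=> //=; rewrite szf.
      by rewrite drop_drop addnC.
    + case=> [|f1 fs] // u' [szf]; rewrite /encs /= -catA => e; exists fs => //.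
      congr (_ :: _); case: f1 e => // m' xs' ys' /key [ex ey _].
      by apply: enc_inj; rewrite /= ex ey.
    + lia.
    + by rewrite catA.
    + by rewrite catA.
    + exact: hst'.
    + move: sh; rewrite -catA /codes -map_cat -flatten_cat -map_cat.
      by rewrite sz drop_drop.
  have pp : p.+1 + (size (enc_vars xs)).+1 + (size (enc_vars ys)).+1 = p + size (enc phi).
    by rewrite szp; lia.
  rewrite pp; case: a {hst ea fin bad} @phi eu2 szp hfin pp => phi eu2 szp hfin pp; wp_calc.
    apply: hfin; [by [] | by [] | by rewrite /=; lia |].
    rewrite !upd_ind sz; by do 11 eexists.
  apply: (hfin _ [::] [::]) => //; first by rewrite /=; lia.
  rewrite !cats0 sz; by do 11 eexists.
- by apply: bad => [|[]] //=; lia.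
- rewrite {1}/do_and; wp_calc.
  (* The default [[::]] is never met: two flags have just been pushed, so the forest has at least
     two formulas. *)
  apply: (fin [:: SAnd] u [:: a, a & st] [::] [::] [::] L g
    (fun fs => if fs is [:: f1, f2 & fs'] then PAnd f1 f2 :: fs' else [::])
    (upd (upd stk (size st) a) (size st).+1 a) cell) => //.
  + by rewrite /=; lia.
  + move=> [|f1 [|f2 fs]] //= [sz]; rewrite /encs /farity /fguesses /= sz.
    rewrite -!catA -!andbA !drop_drop !addnA maxnA (addnC (guesses f2)).
    have -> : p + (size (enc f1 ++ enc f2)).+1 =
      p.+1 + size (enc f1) + size (enc f2) by rewrite size_cat; lia.
    by rewrite !addn1.
  + case=> [|[] f1] //= f2 fs u' [sz]; exists [:: f1, f2 & fs] => //=.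
    by rewrite sz.
  + by rewrite cats0.
  + by rewrite cats0.
  + by apply: (@stacked_cons _ a (a :: st)); apply: stacked_cons.
  + rewrite /= !cats0 !addn1 addn2; by do 11 eexists.
- rewrite {1}/do_or; wp_calc.
  set cc := head false g.
  have -> : nat_of_bool a - cc = nat_of_bool (a && ~~ cc) by case: (a) cc => [] [].
  have -> : nat_of_bool a - nat_of_bool (a && ~~ cc) = nat_of_bool (a && cc).
    by case: (a) cc => [] [].
  apply: (fin [:: SOr] u [:: a && cc, a && ~~ cc & st] [::] [::] [::] L (behead g)
    (fun fs => if fs is [:: f1, f2 & fs'] then POr f1 f2 :: fs' else [::])
    (upd (upd stk (size st) (nat_of_bool (a && ~~ cc))) (size st).+1
      (nat_of_bool (a && cc))) cell) => //.
  + by rewrite /=; lia.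
  + move=> [|f1 [|f2 fs]] //= [sz]; rewrite /encs /farity /fguesses /= sz.
    rewrite -!catA -!andbA !drop_drop !addnA maxnA (addnC (guesses f2)).
    have -> : p + (size (enc f1 ++ enc f2)).+1 =
      p.+1 + size (enc f1) + size (enc f2) by rewrite size_cat; lia.
    have eg m : drop m.+1 g = drop m (behead g).
      by rewrite -drop1 drop_drop addn1.
    by rewrite !addn1 !addSn !eg.
  + case=> [|[] f1] //= f2 fs u' [sz]; exists [:: f1, f2 & fs] => //=.
    by rewrite sz.
  + by rewrite cats0.
  + by rewrite cats0.
  + apply: (@stacked_cons _ (a && cc) ((a && ~~ cc) :: st)).
    exact: stacked_cons.
  + rewrite /= !cats0 !addn1 addn2; by do 11 eexists.
- by apply: bad => [|[]] //=; lia.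
- by apply: bad => [|[]] //=; lia.
- by case: cb su hd hd1 fin bad => su hd hd1 fin bad; wp_calc;
    apply: bad => [|[]] //=; lia.
Qed.

(** * Passes and the final check *)

Definition admissible (phi : formula) (g : seq bool) : bool :=
  coherent (lits phi g) && valid phi true g.

Definition stamps_below (cell : nat -> nat) (i : nat) : Prop :=
  forall x b, cell (x + x + nat_of_bool b) < i.

Lemma stamps_below_stamped cell i : stamps_below cell i -> stamped cell i [::].
Proof. by move=> h x b; have := h x b; rewrite in_nil; lia. Qed.

Lemma stamped_stamps_below cell i s : stamped cell i s -> stamps_below cell i.+1.
Proof. by move=> h x b; have [] := h x b. Qed.

Definition pass_post w i L D N H inp o g tk (r : res) : Prop :=
  match r with
  | Ok s => exists phi p stk cell tk',
      [/\ w = enc phi /\ admissible phi g, stamps_below cell i.+1,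
          tk' <= tk + 100 * size w + 10 &
          shape w p 0 i (maxn L (D * 2 ^ arity phi)) D stk cell
            (N ++ map (address D) (keys false phi 0 true g))
            (H ++ map (address D) (keys true phi 0 true g)) inp
            (o ++ codes (enc_assignment (lits phi g)))
            (drop (guesses phi) g) tk' s]
  | Ko t => t <= tk + 100 * (size w).+1 + 10 /\
      forall phi, w = enc phi -> ~~ admissible phi g
  end.

Lemma pass_spec w p sp i L D stk cell N H inp o g tk s :
  size w < D -> D <= L -> stamps_below cell i ->
  shape w p sp i L D stk cell N H inp o g tk s ->
  wp pass s (pass_post w i L D N H inp o g tk).
Proof.
move=> hD hL /stamps_below_stamped hs.
case=> ra [t [rb [v [wt [q [rx [ry [z [d [f ->]]]]]]]]]].
set K := pass_post _ _ _ _ _ _ _ _ _ _; rewrite /pass; wp_calc.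
have hst : stacked (upd stk 0 1) [:: true] by apply: (@stacked_cons _ true [::]).
apply: wp_mono.
  apply: (@items_spec w w 0 [::] [:: true] N H i L D inp o g tk.+3
    (upd stk 0 1) cell) => //.
  - by rewrite drop0.
  - by do 11 eexists.
case=> [s'|t'] /=; last first.
  case=> le h; split; first lia.
  move=> phi e; have := h [:: phi] [::] erefl.
  by rewrite /encs /= !cats0 andbT; apply.
case=> fs [u' [stk' [cell' [tk' [[sz e hc hv] hs' le sh]]]]].
case: fs sz e hc hv hs' le sh => [|phi [|//]] // _.
rewrite /encs /farity /fguesses /= !cats0 !addn0 add0n maxn0 andbT.
move=> e hc hv hs' le [ra' [t1 [rb' [v' [wt' [q' [rx' [ry' [z' [d' [f' ->]]]]]]]]]]].
have hd : drop (size (enc phi)) w = u' by rewrite e drop_size_cat.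
wp_calc; rewrite (tokE hd).
case: u' e hd => [|c u'] e hd; wp_calc; last first.
  have -> : code c = (code c).-1.+1 by case: (c) => // -[].
  wp_calc; split; first by rewrite e size_cat; lia.
  move=> psi e'; have : enc phi ++ c :: u' = enc psi ++ [::] by rewrite cats0 -e.
  by case/enc_cat.
rewrite cats0 in e.
exists phi; do 4 eexists; split; last first.
- rewrite /enc_assignment {1}/codes map_rcons -rcons_cat; do 11 eexists.
  reflexivity.
- by rewrite /= e; lia.
- exact: stamped_stamps_below hs'.
- by rewrite /admissible hc.
Qed.

(** An entry is the whole list of guesses still available when its pass begins; the pass uses the
    first [guesses phi] of them. *)
Fixpoint entries (phi : formula) (m : nat) (g : seq bool) : seq (seq bool) :=
  if m is m'.+1 then g :: entries phi m' (drop (guesses phi) g) else [::].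

Definition all_keys (h : bool) (D : nat) (phi : formula) (es : seq (seq bool)) :
    seq nat :=
  flatten [seq map (address D) (keys h phi 0 true g) | g <- es].

Definition passes_post w phi m L D N H inp o g tk (r : res) : Prop :=
  let es := entries phi m g in
  match r with
  | Ok s => all (admissible phi) es /\
      exists p i stk cell g' tk', tk' <= tk + m * (100 * size w + 120) + 1 /\
          shape w p 0 i L D stk cell
            (N ++ all_keys false D phi es) (H ++ all_keys true D phi es) inp
            (o ++ codes (enc_team (map (lits phi) es))) g' tk' s
  | Ko t => t <= tk + m * (100 * size w + 120) + 1 /\ ~~ all (admissible phi) es
  end.

(** After one pass [rL] has its final value, because all passes read the same formula; so the number
    [m] of remaining passes satisfies [m + i = L]. *)
Lemma passes_rec w phi m p i L D stk cell N H inp o g tk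
    ra t rb v wt q rx ry z d :
  w = enc phi -> size w < D -> L = D * 2 ^ arity phi -> m + i = L ->
  stamps_below cell i.+1 ->
  wp passes (State [:: p; 0; ra; t; rb; v; wt; q; i.+1; L; D; rx; ry; z; d; m]
               [:: tok w; stk; cell; ind N; ind H] inp o g tk)
    (passes_post w phi m L D N H inp o g tk).
Proof.
move=> ew hD eL; have hL : D <= L by rewrite eL leq_pmulr // expn_gt0.
elim: m p i stk cell N H o g tk ra t rb v wt q rx ry z d
  => [|m IH] p i stk cell N H o g tk ra t rb v wt q rx ry z d hm hs.
  apply: wp_while0 => //; split=> //; do 6 eexists; split; last first.
    by rewrite /= !cats0; do 11 eexists.
  by rewrite /=; lia.
apply: wp_while1 => //; wp_calc; apply: wp_mono.
  by apply: pass_spec; [exact: hD | exact: hL | exact: hs | do 11 eexists].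
case=> [s'|t'] /=; last first.
  case=> le h; split; first by rewrite mulSn; lia.
  by rewrite /= (negPf (h _ ew)).
case=> phi' [p' [stk' [cell' [tk' [[ew' hp] hs' le]]]]].
have e : phi' = phi by apply: enc_inj; rewrite -ew -ew'.
subst phi'; rewrite -eL maxnn.
case=> ra' [t' [rb' [v' [wt' [q' [rx' [ry' [z' [d' [f' ->]]]]]]]]]].
wp_calc; have -> : L - i.+1 = m by lia.
rewrite addn1; apply: wp_mono; first by apply: IH => //; lia.
case=> [s''|t''] /=; last first.
  case=> le' h; split; first by rewrite mulSn; lia.
  by rewrite negb_and h orbT.
case=> h [p2 [i2 [stk2 [cell2 [g2 [tk2 [le2 sh]]]]]]].
split; first by rewrite hp.
exists p2, i2, stk2, cell2, g2, tk2; split; first by rewrite mulSn; lia.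
move: sh; rewrite /all_keys /= !catA /enc_team /= /codes map_cat !catA.
by [].
Qed.

(** The first pass is made before the arity is known. It rejects a word that encodes no formula,
    which accordingly costs the time of a single pass. *)
Lemma passes_spec w p ra t rb v wt q rx ry z d stk cell inp tk g :
  stamps_below cell 1 -> let D := (size w).+1 in
  wp passes (State [:: p; 0; ra; t; rb; v; wt; q; 1; D; D; rx; ry; z; d; 1]
               [:: tok w; stk; cell; ind [::]; ind [::]] inp [::] g tk)
    (fun r =>
      (exists2 phi, w = enc phi &
        let M := D * 2 ^ arity phi in
        passes_post w phi M M D [::] [::] inp [::] g tk r) \/
      [/\ (forall phi, w <> enc phi),
         (if r is Ok _ then False else True) & time r <= tk + 100 * size w + 120]).
Proof.
move=> hs D; have hD : size w < D by [].
apply: wp_while1 => //; wp_calc; apply: wp_mono.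
  by apply: pass_spec; [exact: hD | exact: leqnn | exact: hs | do 11 eexists].
case=> [s'|t'] /=; last first.
  case=> le h; case: (pselect (exists phi, w = enc phi)) => [[phi ew]|nw].
    left; exists phi => //; have := h _ ew.
    have : 0 < D * 2 ^ arity phi by rewrite muln_gt0 /= expn_gt0.
    case: (D * 2 ^ arity phi) => // m _ /negPf h'; split; last by rewrite /= h'.
    by rewrite mulSn; lia.
  right; split=> //; last by rewrite /=; lia.
  by move=> phi e; apply: nw; exists phi.
case=> phi [p' [stk' [cell' [tk' [[ew hp] hs' le]]]]].
set M := D * 2 ^ arity phi.
have hDM : D <= M by rewrite leq_pmulr // expn_gt0.
rewrite (maxn_idPr hDM).
case=> ra' [t' [rb' [v' [wt' [q' [rx' [ry' [z' [d' [f' ->]]]]]]]]]].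
wp_calc; rewrite addn1.
have M0 : M = (M - 1).+1 by lia.
apply: wp_mono; first by apply: (@passes_rec w phi (M - 1)) => //; lia.
move=> r hr; left; exists phi => //; rewrite -/M {1}M0.
case: r hr => [s''|t''] /=; last first.
  case=> le' h; split; first by rewrite mulSn; lia.
  by rewrite negb_and h orbT.
case=> h [p2 [i2 [stk2 [cell2 [g2 [tk2 [le2 sh]]]]]]].
split; first by rewrite hp.
exists p2, i2, stk2, cell2, g2, tk2; split; first by rewrite mulSn; lia.
by move: sh; rewrite /all_keys /enc_team /= /codes map_cat.
Qed.

Lemma check_spec m p sp i D stk cell N H tk toks ra t rb v wt q rx ry z d f inp o g :
  wp check (State [:: p; sp; ra; t; rb; v; wt; q; i; m; D; rx; ry; z; d; f]
              [:: toks; stk; cell; ind N; ind H] inp o g tk)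
    (fun r => time r <= tk + 5 * m + 1 /\
      match r with
      | Ok s => (forall k, k < m -> k \in N -> k \in H) /\ out s = o
      | Ko _ => ~ (forall k, k < m -> k \in N -> k \in H)
      end).
Proof.
elim: m tk => [|m IH] tk; first by apply: wp_while0; rewrite //= addn1 muln0 addn0.
have next tk' : tk' <= tk + 5 -> (m \in N -> m \in H) ->
  wp check (State [:: p; sp; ra; t; rb; v; wt; q; i; m; D; rx; ry; z; d; f]
              [:: toks; stk; cell; ind N; ind H] inp o g tk')
    (fun r => time r <= tk + 5 * m.+1 + 1 /\
      match r with
      | Ok s => (forall k, k < m.+1 -> k \in N -> k \in H) /\ out s = o
      | Ko _ => ~ (forall k, k < m.+1 -> k \in N -> k \in H)
      end).
  move=> le hm; apply: wp_mono (IH tk') _ => r [ler hr]; split; first by lia.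
  case: r {ler} hr => [s [h ->]|t' h].
    split=> // k; rewrite ltnS leq_eqVlt => /orP [/eqP ->//|]; exact: h.
  by move=> h'; apply: h => k lt; apply: h'; apply: ltnW.
set K := fun r => _ in next *; apply: wp_while1 => //.
wp_calc.
rewrite {1}/ind; case mN: (m \in N); wp_calc; last first.
  by apply: next; [lia | rewrite mN].
rewrite {1}/ind; case mH: (m \in H); wp_calc.
  by apply: next; [lia | ].
rewrite /K; split=> /=; first by lia.
by move=> /(_ m (ltnSn m) mN); rewrite mH.
Qed.

Lemma load_spec w g :
  wp load (start (codes w) g) (fun r => exists2 tk, tk <= 4 * size w + 2 &
    r = Ok (State [:: size w; 0; 0; 0; 0; 0; 0; 0; 0; 0; 0; 0; 0; 0; 0; 0]
              [:: tok w; ind [::]; ind [::]; ind [::]; ind [::]] [::] [::] g tk)).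
Proof.
rewrite /load /start; wp_calc.
have -> : (fun=> 0) = tok [::] by apply/funext => j; rewrite /tok nth_nil.
suff h u v tk : w = v ++ u -> wp
    (While (Reg rT)
       (Put TOK (Reg rP) (Reg rT);; Assign rP (Plus (Reg rP) 1);; Read rT))
    (State [:: size v; 0; 0; head 0 (codes u); 0; 0; 0; 0; 0; 0; 0; 0; 0; 0; 0; 0]
       [:: tok v; ind [::]; ind [::]; ind [::]; ind [::]]
       (behead (codes u)) [::] g tk)
    (fun r => exists2 tk', tk' <= tk + 4 * size u + 1 &
      r = Ok (State [:: size w; 0; 0; 0; 0; 0; 0; 0; 0; 0; 0; 0; 0; 0; 0; 0]
                [:: tok w; ind [::]; ind [::]; ind [::]; ind [::]] [::] [::] g tk')).
  have e0 : tok [::] = ind [::] by apply/funext => j; rewrite /tok nth_nil.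
  have := h w [::] 1 erefl; rewrite -e0 => h1; apply: wp_mono h1 _.
  by move=> r [tk' le ->]; exists tk' => //; lia.
elim: u v tk => [|c u IH] v tk ew.
  apply: wp_while0 => //; exists tk.+1; first by rewrite /=; lia.
  by rewrite ew cats0.
apply: wp_while1; first by case: (c) => // -[].
wp_calc.
have -> : upd (tok v) (size v) (code c) = tok (rcons v c).
  apply/funext => j; rewrite /upd /tok /codes map_rcons nth_rcons size_map.
  by case: ltngtP => // h; rewrite nth_default // size_map ltnW.
have ev : w = rcons v c ++ u by rewrite cat_rcons.
rewrite addn1; have := IH _ tk.+4 ev; rewrite size_rcons => h; apply: wp_mono h _.
by move=> r [tk' le ->]; exists tk' => //; lia.
Qed.

(** Both the number of passes and a strict bound on the addresses of keys. *)
Definition limit (phi : formula) : nat := (size (enc phi)).+1 * 2 ^ arity phi.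

Definition good (phi : formula) (g : seq bool) : Prop :=
  let D := (size (enc phi)).+1 in
  let es := entries phi (limit phi) g in
  all (admissible phi) es /\
  forall k, k < limit phi -> k \in all_keys false D phi es ->
    k \in all_keys true D phi es.

Lemma pinc_arity_enc phi : pinc_arity (enc phi) = arity phi.
Proof.
rewrite /pinc_arity; case: pselect => [e|ne]; last by case: ne; exists phi.
by case: cid => psi /= /enc_inj ->.
Qed.

Lemma sat_cmd_spec w g : wp sat_cmd (start (codes w) g) (fun r =>
  time r <= 400 * ((size w).+1 ^ 2 * 2 ^ pinc_arity w) /\
  match r with
  | Ok s => exists phi, [/\ w = enc phi, good phi g &
      out s = codes (enc_team (map (lits phi) (entries phi (limit phi) g)))]
  | Ko _ => forall phi, w = enc phi -> ~ good phi g
  end).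
Proof.
set K := fun r => _; rewrite /sat_cmd; wp_step.
apply: wp_mono (load_spec w g) _ => _ [tk le ->]; wp_calc; rewrite addn1.
apply: wp_mono; first by apply: passes_spec.
have pos : 0 < 2 ^ pinc_arity w by rewrite expn_gt0.
have big : (size w).+1 <= (size w).+1 ^ 2 * 2 ^ pinc_arity w.
  by rewrite expnS expn1 -mulnA leq_pmulr // muln_gt0.
move=> r [[phi ew]|[nw nr ler]] /=; last first.
  case: r nr ler => // t _ /= ler.
  by split=> [|phi /nw //]; rewrite /=; lia.
have eM : (size w).+1 * 2 ^ arity phi = limit phi by rewrite ew.
rewrite eM => hr.
(* Loading is linear, each of the [limit phi] passes takes at most [100 * size w + 120] ticks, and
   the final comparison 5 ticks per address; [limit phi] contributes the second factor [(size w).+1]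
   and the power of two. *)
have bd t : t <= tk + 10 + limit phi * (100 * size w + 130) ->
    t <= 400 * ((size w).+1 ^ 2 * 2 ^ pinc_arity w).
  rewrite -eM (_ : pinc_arity w = arity phi) => [h|]; last by rewrite ew pinc_arity_enc.
  apply: leq_trans h _.
  have : 0 < 2 ^ arity phi by rewrite expn_gt0.
  by move: (2 ^ arity phi) => X; rewrite expnS expn1; nia.
case: r hr => [s|t] /=; last first.
  case=> let_ hna; split=> /=; first by apply: bd; nia.
  by move=> psi; rewrite ew => /enc_inj <- [ha _]; rewrite ha in hna.
case=> hall [p [i [stk [cell [g' [tk' [le' sh]]]]]]].
case: sh => ra [t [rb [v [wt [q [rx [ry [z [d [f ->]]]]]]]]]].
apply: wp_mono; first by apply: check_spec.
have neq : good phi g <-> forall k, k < limit phi ->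
     k \in [::] ++ all_keys false (size w).+1 phi (entries phi (limit phi) g) ->
     k \in [::] ++ all_keys true (size w).+1 phi (entries phi (limit phi) g).
  by rewrite /good -ew; split=> [[]|].
move=> r [ler hr]; split; first by apply: bd; nia.
case: r {ler} hr => [s' [h ->]|t' h].
  by exists phi; split=> //; apply/neq.
by move=> psi; rewrite ew => /enc_inj <- /neq.
Qed.

(** * Teams of guessed assignments *)

Lemma mem_vlits x xs g : reflect (exists b, (x, b) \in vlits xs g) (x \in xs).
Proof.
apply: (iffP idP) => [|[b]].
  elim: xs g => //= y xs IH g; rewrite inE => /orP [/eqP ->|/(IH (behead g)) [b h]].
    by exists (head false g); rewrite inE eqxx.
  by exists b; rewrite inE h orbT.
elim: xs g => //= y xs IH g; rewrite !inE xpair_eqE.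
by case/orP=> [/andP [-> //]|/IH ->]; rewrite orbT.
Qed.

Lemma mem_lits x phi g : reflect (exists b, (x, b) \in lits phi g) (x \in vars phi).
Proof.
apply: (iffP idP) => [|[b]].
  elim: phi g => [||y|y|n xs ys|f1 IH1 f2 IH2|f1 IH1 f2 IH2] g //=; rewrite ?inE.
  - by move/eqP=> ->; exists (head false g); rewrite inE eqxx.
  - by move/eqP=> ->; exists (head false g); rewrite inE eqxx.
  - case/orP=> [/(mem_vlits _ _ g)|/(mem_vlits _ _ (drop n g))] [b h]; exists b;
      by rewrite mem_cat h ?orbT.
  - case/orP=> [/(IH1 g)|/(IH2 (drop (guesses f1) g))] [b h]; exists b;
      by rewrite mem_cat h ?orbT.
  - case/orP=> [/(IH1 (behead g))|/(IH2 (drop (guesses f1) (behead g)))] [b h]; exists b;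
      by rewrite mem_cat h ?orbT.
elim: phi g => [||y|y|n xs ys|f1 IH1 f2 IH2|f1 IH1 f2 IH2] g //=;
  rewrite ?mem_cat !inE ?xpair_eqE.
- by case/andP.
- by case/andP.
- by case/orP=> h; apply/orP; [left|right]; apply/mem_vlits; exists b; exact: h.
- by case/orP=> [/IH1 ->|/IH2 ->]; rewrite ?orbT.
- by case/orP=> [/IH1 ->|/IH2 ->]; rewrite ?orbT.
Qed.

Definition assignment_of (V : {fset nat}) (s : seq (nat * bool)) : assignment :=
  [fmap x : V => ((val x, true) \in s)].

(** Every variable of [phi] receives a literal, whichever disjuncts are chosen; hence a coherent
    list determines an assignment with domain exactly [vars phi]. *)
Lemma assignment_ofP phi g : coherent (lits phi g) ->
  lists_assignment (lits phi g) (assignment_of (vars phi) (lits phi g)).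
Proof.
move=> hc x b; rewrite /assignment_of; split=> [h|].
  have xv : x \in vars phi by apply/(mem_lits _ _ g); exists b.
  rewrite in_fnd ffunE /=; congr Some.
  case: b h => // h; apply/negbTE; exact: (allP hc _ h).
case: (boolP (x \in vars phi)) => xv; last by rewrite not_fnd.
rewrite in_fnd ffunE /= => -[<-].
case: (boolP ((x, true) \in lits phi g)) => // h.
by case/(mem_lits _ _ g): xv => -[] // h'; rewrite h' in h.
Qed.

(** Siblings have disjoint intervals of positions, so a position identifies its atom. *)
Lemma keys_bounds h phi p a g (k : nat * seq bool) : k \in keys h phi p a g ->
  p < k.1 <= p + size (enc phi).
Proof.
elim: phi p a g => [||y|y|n xs ys|f1 IH1 f2 IH2|f1 IH1 f2 IH2] p a g //=.
- by case: a; rewrite // inE => /eqP ->; rewrite /= ltnSn addnS ltnS leq_addr.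
- rewrite mem_cat size_cat => /orP [/IH1|/IH2] /andP [lt le]; lia.
- rewrite mem_cat size_cat => /orP [/IH1|/IH2] /andP [lt le]; lia.
Qed.

Lemma keys_size h h' phi p a a' g g' (k k' : nat * seq bool) :
  k \in keys h phi p a g -> k' \in keys h' phi p a' g' -> k.1 = k'.1 ->
  size k.2 = size k'.2.
Proof.
have vs xs r : size (vlits xs r) = size xs by elim: xs r => //= x xs IH r; rewrite IH.
elim: phi p a a' g g' => [||y|y|n xs ys|f1 IH1 f2 IH2|f1 IH1 f2 IH2] p a a' g g' //=.
- case: a a' => [] [] //; rewrite !inE => /eqP -> /eqP -> _ /=.
  by rewrite !size_map; case: h h' => [] []; rewrite !vs !size_tuple.
- rewrite !mem_cat => /orP [] h1 /orP [] h2 e;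
    by [exact: (IH1 _ _ _ _ _ h1 h2 e) | exact: (IH2 _ _ _ _ _ h1 h2 e)
       | have := keys_bounds h1; have := keys_bounds h2; lia].
- rewrite !mem_cat => /orP [] h1 /orP [] h2 e;
    by [exact: (IH1 _ _ _ _ _ h1 h2 e) | exact: (IH2 _ _ _ _ _ h1 h2 e)
       | have := keys_bounds h1; have := keys_bounds h2; lia].
Qed.

Lemma keys_arity h phi p a g (k : nat * seq bool) :
  k \in keys h phi p a g -> size k.2 <= arity phi.
Proof.
have vs xs r : size (vlits xs r) = size xs by elim: xs r => //= x xs IH r; rewrite IH.
elim: phi p a g => [||y|y|n xs ys|f1 IH1 f2 IH2|f1 IH1 f2 IH2] p a g //=.
- by case: a; rewrite // inE => /eqP -> /=; rewrite size_map; case: h;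
    rewrite vs size_tuple.
- by rewrite mem_cat leq_max => /orP [/IH1 ->|/IH2 ->]; rewrite ?orbT.
- by rewrite mem_cat leq_max => /orP [/IH1 ->|/IH2 ->]; rewrite ?orbT.
Qed.

Lemma valb_lt bs : valb bs < 2 ^ size bs.
Proof. by elim: bs => //= b bs IH; rewrite expnS; case: b => /=; lia. Qed.

Lemma valb_inj bs bs' : size bs = size bs' -> valb bs = valb bs' -> bs = bs'.
Proof.
elim: bs bs' => [|b bs IH] [|b' bs'] //= [sz] e.
have eb : b = b' by have := congr1 odd e; rewrite !oddD !odd_double !addbF !oddb.
by congr (_ :: _) => //; apply: IH => //; move: e; rewrite eb => /addnI /double_inj.
Qed.

Lemma address_lt phi h a g k :
  k \in keys h phi 0 a g -> address (size (enc phi)).+1 k < limit phi.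
Proof.
move=> hk; have := keys_bounds hk; have := keys_arity hk; have := valb_lt k.2.
rewrite /address /limit add0n => lt le /andP [_ le'].
have leA : 2 ^ size k.2 <= 2 ^ arity phi by rewrite leq_exp2l.
apply: (@leq_trans ((size (enc phi)).+1 * (valb k.2).+1)).
  by rewrite mulnS ltn_add2r ltnS.
by rewrite leq_pmul2l //; apply: leq_trans lt leA.
Qed.

(** The position is the address modulo [D], and the quotient is the number of the pattern. As [valb]
    ignores [false] at the end of a list, the pattern is recovered only together with its length,
    which the position determines. *)
Lemma address_inj phi h h' a a' g g' k k' :
  k \in keys h phi 0 a g -> k' \in keys h' phi 0 a' g' ->
  address (size (enc phi)).+1 k = address (size (enc phi)).+1 k' -> k = k'.
Proof.
move=> hk hk'; have := keys_bounds hk; have := keys_bounds hk'.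
rewrite /address add0n; set D := (size _).+1 => /andP [_ le'] /andP [_ le] e.
have e1 : k.1 = k'.1.
  have := congr1 (modn^~ D) e; rewrite ![D * _]mulnC ![_ + _ * D]addnC !modnMDl.
  by rewrite !modn_small.
have e2 : valb k.2 = valb k'.2.
  by move: e; rewrite e1 => /addnI /eqP; rewrite eqn_pmul2l // => /eqP.
have e3 := valb_inj (keys_size hk hk' e1) e2.
by case: k k' e1 e3 {hk hk' le le' e e2} => [? ?] [? ?] /= -> ->.
Qed.

Lemma values_vlits (t : assignment) xs g :
  (forall x b, (x, b) \in vlits xs g -> t.[? x]%fmap = Some b) ->
  values t xs = map Some (map snd (vlits xs g)).
Proof.
elim: xs g => //= x xs IH g h; rewrite (h x (head false g)) ?inE ?eqxx //.
by congr (_ :: _); apply: IH => y b yb; apply: h; rewrite inE yb orbT.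
Qed.

(** * Soundness: from accepted guesses to a satisfying team *)

Section Soundness.

Variables (es : seq (seq bool)) (tv : seq bool -> assignment).

Definition team (a : seq bool -> bool) : {fset assignment} :=
  [fset t in map tv (filter a es)]%fset.

Lemma mem_team (a : seq bool -> bool) t :
  reflect (exists h, [/\ h \in es, a h & t = tv h]) (t \in team a).
Proof.
rewrite /team inE /=; apply: (iffP mapP) => [[h]|[h [hes ah ->]]].
  by rewrite mem_filter => /andP [ah hes] ->; exists h.
by exists h; rewrite // mem_filter ah.
Qed.

(** For a fixed list of entries, [a] selects the current subteam and [r h] is the part of the
    guesses of [h] left when the subformula is reached. The condition on keys passes to subformulas
    because positions tell them apart. *)
Lemma sat_team phi p (a : seq bool -> bool) (r : seq bool -> seq bool) :
  (forall h, h \in es -> forall x b, (x, b) \in lits phi (r h) ->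
     (tv h).[? x]%fmap = Some b) ->
  (forall h, h \in es -> valid phi (a h) (r h)) ->
  (forall h, h \in es -> forall k, k \in keys false phi p (a h) (r h) ->
     exists2 h', h' \in es & k \in keys true phi p (a h') (r h')) ->
  sat (team a) phi.
Proof.
elim: phi p a r => [||x|x|n xs ys|f1 IH1 f2 IH2|f1 IH1 f2 IH2] p a r /= hl hv hk.
- by [].
- apply/fsetP => t; rewrite in_fset0; apply/negbTE/negP.
  by case/mem_team=> h [hes ah _]; have := hv _ hes; rewrite ah.
- move=> t /mem_team [h [hes ah ->]]; have := hv _ hes; rewrite ah /= => hh.
  by apply: (hl _ hes); rewrite inE hh.
- move=> t /mem_team [h [hes ah ->]]; have := hv _ hes; rewrite ah /= => hh.
  by apply: (hl _ hes); rewrite inE (negbTE hh).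
- move=> t /mem_team [h [hes ah ->]].
  have := hk _ hes; rewrite ah => /(_ _ (mem_head _ _)) [h' hes'].
  case ah': (a h') => //; rewrite inE => /eqP [e].
  exists (tv h'); first by apply/mem_team; exists h'.
  rewrite (@values_vlits _ _ (r h)); last first.
    by move=> x b xb; apply: (hl _ hes); rewrite mem_cat xb.
  rewrite (@values_vlits _ _ (drop n (r h'))); last first.
    by move=> x b xb; apply: (hl _ hes'); rewrite mem_cat xb orbT.
  by rewrite e.
- split.
  + apply: (IH1 p.+1 a r).
    * by move=> h hes x b xb; apply: hl; rewrite // mem_cat xb.
    * by move=> h /hv /andP [].
    * move=> h hes k hk1; have [|h' hes'] := hk _ hes k; first by rewrite mem_cat hk1.
      rewrite mem_cat => /orP [|h2]; first by exists h'.
      (* A key needed in [f1] cannot be provided in [f2], their positions being disjoint. *)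
      have := keys_bounds hk1; have := keys_bounds h2; lia.
  + apply: (IH2 (p.+1 + size (enc f1)) a (fun h => drop (guesses f1) (r h))).
    * by move=> h hes x b xb; apply: hl; rewrite // mem_cat xb orbT.
    * by move=> h /hv /andP [].
    * move=> h hes k hk1; have [|h' hes'] := hk _ hes k; first by rewrite mem_cat hk1 orbT.
      rewrite mem_cat => /orP [h2|]; last by exists h'.
      have := keys_bounds hk1; have := keys_bounds h2; lia.
- pose a1 h := a h && head false (r h); pose a2 h := a h && ~~ head false (r h).
  exists (team a1), (team a2); split.
  + apply/fsetP => t; rewrite in_fsetU; apply/orP/mem_team.
      by case=> /mem_team [h [hes /andP [ah _] ->]]; exists h.
    case=> h [hes ah ->]; case c: (head false (r h)); [left|right];
      by apply/mem_team; exists h; rewrite /a1 /a2 ah c.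
  + apply: (IH1 p.+1 a1 (fun h => behead (r h))).
    * by move=> h hes x b xb; apply: hl; rewrite // mem_cat xb.
    * by move=> h /hv /andP [].
    * move=> h hes k hk1; have [|h' hes'] := hk _ hes k; first by rewrite mem_cat hk1.
      rewrite mem_cat => /orP [|h2]; first by exists h'.
      have := keys_bounds hk1; have := keys_bounds h2; lia.
  + apply: (IH2 (p.+1 + size (enc f1)) a2 (fun h => drop (guesses f1) (behead (r h)))).
    * by move=> h hes x b xb; apply: hl; rewrite // mem_cat xb orbT.
    * by move=> h /hv /andP [].
    * move=> h hes k hk1; have [|h' hes'] := hk _ hes k; first by rewrite mem_cat hk1 orbT.
      rewrite mem_cat => /orP [h2|]; last by exists h'.
      have := keys_bounds hk1; have := keys_bounds h2; lia.
Qed.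

End Soundness.

Lemma mem_all_keys h D phi es k : reflect
  (exists g, exists2 k', g \in es & k' \in keys h phi 0 true g /\ k = address D k')
  (k \in all_keys h D phi es).
Proof.
apply: (iffP flattenP) => [[s /mapP [g ges ->] /mapP [k' hk ->]]|].
  by exists g, k'.
case=> g [k' ges [hk ->]]; exists (map (address D) (keys h phi 0 true g)).
  by apply/mapP; exists g.
by apply: map_f.
Qed.

Lemma entries_neq0 phi g : entries phi (limit phi) g <> [::].
Proof.
have : 0 < limit phi by rewrite muln_gt0 /= expn_gt0.
by case: (limit phi).
Qed.

Lemma good_witness phi g : good phi g -> exists T,
  encodes_team (enc_team (map (lits phi) (entries phi (limit phi) g))) T /\
  witness phi T.
Proof.
case=> /=; have := @entries_neq0 phi g; set es := entries _ _ _ => ne /allP hall hk.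
pose tv h := assignment_of (vars phi) (lits phi h).
have htv h : h \in es -> lists_assignment (lits phi h) (tv h).
  by move=> /hall /andP [hc _]; apply: assignment_ofP.
exists (team es tv xpredT); split.
  exists (map (lits phi) es); split=> // [s /mapP [h hes ->]|t].
    by exists (tv h); [apply/mem_team; exists h | apply: htv].
  case/mem_team=> h [hes _ ->]; exists (lits phi h); last exact: htv.
  exact: map_f.
exists (vars phi); split.
- exact: fsubset_refl.
- by move=> t /mem_team [h [_ _ ->]].
- case: es ne {hall hk} htv => // h es _ htv e.
  have := in_fset0 (tv h); rewrite -e.
  by move/negP; apply; apply/mem_team; exists h; rewrite inE eqxx.
- apply: (sat_team (p := 0) (r := id)) => [h hes x b xb|h|h hes k hkk].
  + exact/(htv _ hes x b).
  + by case/hall/andP.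
  + have hk1 : address (size (enc phi)).+1 k \in
        all_keys false (size (enc phi)).+1 phi es.
      by apply/mem_all_keys; exists h, k.
    (* The tables only compare addresses; injectivity turns equal addresses into equal keys. *)
    have /mem_all_keys [h' [k' hes' [hk' e]]] := hk _ (address_lt hkk) hk1.
    by exists h' => //; rewrite (address_inj hkk hk' e).
Qed.

(** * Completeness: from a satisfying team to guesses *)

Definition agree (n : nat) (g g' : seq bool) : Prop :=
  forall j, j < n -> nth false g j = nth false g' j.

Lemma agree_drop n m g g' : agree (n + m) g g' -> agree m (drop n g) (drop n g').
Proof. by move=> h j lt; rewrite !nth_drop h // ltn_add2l. Qed.

Lemma agree_behead n g g' : agree n.+1 g g' -> agree n (behead g) (behead g').
Proof. by move=> h j lt; rewrite !nth_behead h. Qed.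

Lemma agree_head n g g' : agree n.+1 g g' -> head false g = head false g'.
Proof. by move=> h; rewrite -!nth0 h. Qed.

Lemma agree_le n m g g' : n <= m -> agree m g g' -> agree n g g'.
Proof. by move=> le h j lt; apply: h; apply: leq_trans lt le. Qed.

Lemma vlits_agree xs g g' : agree (size xs) g g' -> vlits xs g = vlits xs g'.
Proof.
elim: xs g g' => //= x xs IH g g' h; rewrite (agree_head h).
by rewrite (IH _ (behead g')) //; apply: agree_behead.
Qed.

Lemma guesses_agree phi g g' : agree (guesses phi) g g' ->
  [/\ lits phi g = lits phi g',
      forall a, valid phi a g = valid phi a g' &
      forall h p a, keys h phi p a g = keys h phi p a g'].
Proof.
elim: phi g g' => [||y|y|n xs ys|f1 IH1 f2 IH2|f1 IH1 f2 IH2] g g' //= h.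
- by rewrite (agree_head h).
- by rewrite (agree_head h).
- rewrite (@vlits_agree xs g g') 1?(@vlits_agree ys _ (drop n g')) //.
    by rewrite size_tuple; apply: agree_drop h.
  by rewrite size_tuple; apply: agree_le h; apply: leq_addr.
- have [l1 v1 k1] := IH1 _ _ (agree_le (leq_addr _ _) h).
  have [l2 v2 k2] := IH2 _ _ (agree_drop h).
  by split=> [|a|b p a]; rewrite ?l1 ?l2 ?v1 ?v2 ?k1 ?k2.
- have [l1 v1 k1] := IH1 _ _ (agree_le (leq_addr _ _) (agree_behead h)).
  have [l2 v2 k2] := IH2 _ _ (agree_drop (agree_behead h)).
  by split=> [|a|b p a]; rewrite ?(agree_head h) ?l1 ?l2 ?v1 ?v2 ?k1 ?k2.
Qed.

Lemma agree_cat g r : agree (size g) (g ++ r) g.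
Proof. by move=> j lt; rewrite nth_cat lt. Qed.

Lemma map_entries_flatten (X : Type) (F : seq bool -> X) phi gs :
  (forall g g', agree (guesses phi) g g' -> F g = F g') ->
  (forall g, g \in gs -> size g = guesses phi) ->
  map F (entries phi (size gs) (flatten gs)) = map F gs.
Proof.
move=> hF; elim: gs => //= g gs IH sz.
have sg : size g = guesses phi by apply: sz; rewrite inE eqxx.
rewrite -sg drop_size_cat // IH; last first.
  by move=> h hh; apply: sz; rewrite inE hh orbT.
by congr (_ :: _); apply: hF; rewrite -sg; apply: agree_cat.
Qed.

Definition tval (t : assignment) (x : nat) : bool := odflt false t.[? x]%fmap.

Definition follows (t : assignment) (s : seq (nat * bool)) : bool :=
  all (fun l => l.2 == tval t l.1) s.

Lemma follows_coherent t s : follows t s -> coherent s.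
Proof.
move=> /allP h; apply/allP => -[x b] /h /= /eqP e; apply/negP => /h /= /eqP.
by rewrite -e; case: b e.
Qed.

Lemma vlits_cat_map (t : assignment) xs r :
  vlits xs (map (tval t) xs ++ r) = [seq (x, tval t x) | x <- xs].
Proof. by elim: xs => //= x xs ->. Qed.

Lemma follows_map t xs : follows t [seq (x, tval t x) | x <- xs].
Proof. by apply/allP => l /mapP [x _ ->] /=. Qed.

Lemma follows_cat t s1 s2 : follows t (s1 ++ s2) = follows t s1 && follows t s2.
Proof. exact: all_cat. Qed.

(* [A] is the set of keys that the team provides. *)
Definition threads (A : nat * seq bool -> Prop) phi p t a g : Prop :=
  [/\ size g = guesses phi, follows t (lits phi g), valid phi a g &
      forall k, k \in keys false phi p a g -> A k].

Lemma threads_sub (A B : nat * seq bool -> Prop) phi p t a g :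
  (forall k, A k -> B k) -> threads A phi p t a g -> threads B phi p t a g.
Proof. by move=> h [sz fo va ke]; split=> // k /ke /h. Qed.

Lemma guesses_cat phi g r : size g = guesses phi ->
  [/\ lits phi (g ++ r) = lits phi g,
      forall a, valid phi a (g ++ r) = valid phi a g,
      forall h p a, keys h phi p a (g ++ r) = keys h phi p a g &
      drop (guesses phi) (g ++ r) = r].
Proof.
move=> sz; have [l v k] := @guesses_agree phi (g ++ r) g ltac:(rewrite -sz; exact: agree_cat).
by split=> //; rewrite -sz drop_size_cat.
Qed.

Lemma threads_and (A : nat * seq bool -> Prop) f1 f2 p t a g1 g2 :
  threads A f1 p.+1 t a g1 -> threads A f2 (p.+1 + size (enc f1)) t a g2 ->
  threads A (PAnd f1 f2) p t a (g1 ++ g2) /\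
  forall h, keys h (PAnd f1 f2) p a (g1 ++ g2) =
    keys h f1 p.+1 a g1 ++ keys h f2 (p.+1 + size (enc f1)) a g2.
Proof.
case=> s1 fo1 v1 k1 [s2 fo2 v2 k2]; have [el ev ek ed] := guesses_cat g2 s1.
split=> [|h]; last by rewrite /= ek ed.
split; rewrite /= ?size_cat ?s1 ?s2 ?follows_cat ?el ?ev ?ek ?ed ?fo1 ?fo2 ?v1 ?v2 //.
by move=> k; rewrite mem_cat => /orP [/k1|/k2].
Qed.

Lemma threads_or (A : nat * seq bool -> Prop) f1 f2 p t a c g1 g2 :
  threads A f1 p.+1 t (a && c) g1 ->
  threads A f2 (p.+1 + size (enc f1)) t (a && ~~ c) g2 ->
  threads A (POr f1 f2) p t a (c :: g1 ++ g2) /\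
  forall h, keys h (POr f1 f2) p a (c :: g1 ++ g2) =
    keys h f1 p.+1 (a && c) g1 ++
    keys h f2 (p.+1 + size (enc f1)) (a && ~~ c) g2.
Proof.
case=> s1 fo1 v1 k1 [s2 fo2 v2 k2]; have [el ev ek ed] := guesses_cat g2 s1.
split=> [|h]; last by rewrite /= ek ed.
split; rewrite /= ?size_cat ?s1 ?s2 ?follows_cat ?el ?ev ?ek ?ed ?fo1 ?fo2 ?v1 ?v2 //.
by move=> k; rewrite mem_cat => /orP [/k1|/k2].
Qed.

(** With [a] false a thread exists for every assignment, which covers the subformulas it reads
    without belonging to their subteam. The second clause makes each key of [A] available from a
    single member of [T], so that one assignment per key will be enough. *)
Lemma sat_threads phi p T : sat T phi ->
  exists A : nat * seq bool -> Prop,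
    (forall t (a : bool), (a -> t \in T) -> exists g, threads A phi p t a g) /\
    (forall k, A k -> exists2 t, t \in T &
       exists g, threads A phi p t true g /\ k \in keys true phi p true g).
Proof.
have tvE t xs : map (tval t) xs = map (odflt false) (values t xs).
  by rewrite /values -map_comp.
elim: phi p T => [||x|x|n xs ys|f1 IH1 f2 IH2|f1 IH1 f2 IH2] p T /=.
- by move=> _; exists (fun=> False); split=> // t a _; exists [::]; split.
- move=> ->; exists (fun=> False); split=> // t [/(_ isT)|_].
    by rewrite in_fset0.
  by exists [::]; split.
- move=> h; exists (fun=> False); split=> // t a ta; exists [:: tval t x].
  split; rewrite //= ?eqxx //.
  by apply/implyP => /ta /h; rewrite /tval => ->.
- move=> h; exists (fun=> False); split=> // t a ta; exists [:: tval t x].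
  split; rewrite //= ?eqxx //.
  by apply/implyP => /ta /h; rewrite /tval => ->.
(* The keys are the patterns of the team on [xs]; by the inclusion atom each of them occurs on
   [ys]. *)
- move=> h; pose A (k : nat * seq bool) := exists2 t, t \in T & k = (p.+1, map (tval t) xs).
  have th t (a : bool) : (a -> t \in T) ->
      threads A (PInc xs ys) p t a (map (tval t) xs ++ map (tval t) ys ++ [::]) /\
      keys true (PInc xs ys) p a (map (tval t) xs ++ map (tval t) ys ++ [::]) =
        if a then [:: (p.+1, map (tval t) ys)] else [::].
    move=> ta.
    have e : drop n (map (tval t) xs ++ map (tval t) ys ++ [::]) = map (tval t) ys ++ [::].
      by rewrite drop_size_cat // size_map size_tuple.
    have e2 zs : map snd [seq (x, tval t x) | x <- zs] = map (tval t) zs.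
      by rewrite -map_comp.
    split; last by rewrite /= e vlits_cat_map e2.
    split=> //=.
    + by rewrite cats0 size_cat !size_map !size_tuple.
    + by rewrite e !vlits_cat_map follows_cat !follows_map.
    + move=> k; case: a ta => // /(_ isT) tT; rewrite inE vlits_cat_map e2 => /eqP ->.
      by exists t.
  exists A; split=> [t a /th [ht _]|k [t tT ->]].
    by eexists; exact: ht.
  have [t' t'T e] := h _ tT; exists t' => //.
  have [|ht hk] := th t' true; first by [].
  exists (map (tval t') xs ++ map (tval t') ys ++ [::]); split=> //.
  suff: (p.+1, map (tval t) xs) \in [:: (p.+1, map (tval t') ys)] by rewrite -hk.
  by rewrite !tvE e inE.
- case=> /(IH1 p.+1) [A1 [h1 k1]] /(IH2 (p.+1 + size (enc f1))) [A2 [h2 k2]].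
  pose A k := A1 k \/ A2 k.
  have s1 k : A1 k -> A k by left.
  have s2 k : A2 k -> A k by right.
  exists A; split=> [t a ta|k [hk|hk]].
  + have [g1 /(threads_sub s1) t1] := h1 t a ta; have [g2 /(threads_sub s2) t2] := h2 t a ta.
    by exists (g1 ++ g2); case: (threads_and t1 t2).
  + have [t tT [g1 [/(threads_sub s1) t1 hk1]]] := k1 k hk.
    have [g2 /(threads_sub s2) t2] := h2 t true (fun=> tT).
    exists t => //; exists (g1 ++ g2); have [t12 ek] := threads_and t1 t2.
    by split=> //; rewrite -/(keys true (PAnd f1 f2) p true _) ek mem_cat hk1.
  + have [t tT [g2 [/(threads_sub s2) t2 hk2]]] := k2 k hk.
    have [g1 /(threads_sub s1) t1] := h1 t true (fun=> tT).
    exists t => //; exists (g1 ++ g2); have [t12 ek] := threads_and t1 t2.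
    by split=> //; rewrite -/(keys true (PAnd f1 f2) p true _) ek mem_cat hk2 orbT.
- case=> T1 [T2 [<-]] /(IH1 p.+1) [A1 [h1 k1]] /(IH2 (p.+1 + size (enc f1))) [A2 [h2 k2]].
  pose A k := A1 k \/ A2 k.
  have s1 k : A1 k -> A k by left.
  have s2 k : A2 k -> A k by right.
  exists A; split=> [t a ta|k [hk|hk]].
  (* By default an assignment of [T1] is sent to the left and any other to the right. *)
  + have [g1 /(threads_sub s1) t1] := h1 t (a && (t \in T1)) (fun e => proj2 (andP e)).
    have hh : a && ~~ (t \in T1) -> t \in T2.
      by case/andP=> /ta; rewrite in_fsetU => /orP [->|].
    have [g2 /(threads_sub s2) t2] := h2 t _ hh.
    by exists ((t \in T1) :: g1 ++ g2); case: (threads_or t1 t2).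
  + have [t tT [g1 [/(threads_sub s1) t1 hk1]]] := k1 k hk.
    have [|g2 /(threads_sub s2) t2] := h2 t false; first by [].
    exists t; first by rewrite in_fsetU tT.
    exists (true :: g1 ++ g2);
    have [t12 ek] := @threads_or A f1 f2 p t true true g1 g2 t1 t2.
    have hk' : k \in keys true (POr f1 f2) p true (true :: g1 ++ g2).
      by rewrite ek mem_cat hk1.
    by split.
  + have [t tT [g2 [/(threads_sub s2) t2 hk2]]] := k2 k hk.
    have [|g1 /(threads_sub s1) t1] := h1 t false; first by [].
    exists t; first by rewrite in_fsetU tT orbT.
    (* To provide a key of the right disjunct the assignment is sent there, even if it also lies in
       [T1]. *)
    exists (false :: g1 ++ g2);
    have [t12 ek] := @threads_or A f1 f2 p t true false g1 g2 t1 t2.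
    have hk' : k \in keys true (POr f1 f2) p true (false :: g1 ++ g2).
      by rewrite ek mem_cat hk2 orbT.
    by split.
Qed.

(** The [n]-th pass follows a thread providing a key of address [n] if [A] has one, and an arbitrary
    thread otherwise. All needed keys lie in [A], so each needed address is provided by the pass
    with that number. *)
Lemma satisfiable_good phi : satisfiable phi -> exists g, good phi g.
Proof.
case=> T [V [_ _ ne /(sat_threads 0) [A [h1 h2]]]].
have [t0 t0T] : exists t, t \in T.
  by apply/fset0Pn/eqP.
set D := (size (enc phi)).+1.
have ex (n : nat) : exists g, [/\ size g = guesses phi, admissible phi g,
    forall k, k \in keys false phi 0 true g -> A k &
    (exists2 k, A k & address D k = n) ->
      exists2 k, k \in keys true phi 0 true g & address D k = n].
  have fin t g : threads A phi 0 t true g -> [/\ size g = guesses phi, admissible phi g &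
      forall k, k \in keys false phi 0 true g -> A k].
    by case=> sz fo va ke; split=> //; rewrite /admissible (follows_coherent fo).
  case: (pselect (exists2 k, A k & address D k = n)) => [[k Ak ek]|no].
    have [t tT [g [/fin [sz ad ke] hk]]] := h2 _ Ak.
    by exists g; split=> // _; exists k.
  have [g /fin [sz ad ke]] := h1 t0 true (fun=> t0T).
  by exists g; split.
have [e he] := choice ex.
pose gs := mkseq e (limit phi).
have sgs : size gs = limit phi by rewrite size_mkseq.
have szs g : g \in gs -> size g = guesses phi.
  by case/mapP=> j _ ->; have [] := he j.
have ent (X : Type) (F : seq bool -> X) :
    (forall g g', agree (guesses phi) g g' -> F g = F g') ->
    map F (entries phi (limit phi) (flatten gs)) = map F gs.
  by move=> hF; rewrite -sgs; apply: map_entries_flatten.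
exists (flatten gs); split.
  have -> : all (admissible phi) =1 fun s => all id (map (admissible phi) s).
    by move=> s; rewrite all_map.
  rewrite ent.
    rewrite all_map; apply/allP => g /mapP [j _ ->]; by have [] := he j.
  by move=> g g' /guesses_agree [el ev _]; rewrite /admissible el ev.
move=> n lt; rewrite /all_keys !ent; try by move=> g g' /guesses_agree [_ _ ->].
rewrite -!/(all_keys _ _ _ gs) => /mem_all_keys [g [k [gin [hk en]]]].
have Ak : A k by case/mapP: gin hk => j _ -> hk; have [_ _ h _] := he j; apply: h.
have [_ _ _ h] := he n; have [|k' hk' e'] := h; first by exists k.
apply/mem_all_keys; exists (e n), k'; first by apply: map_f; rewrite mem_iota.
by split.
Qed.

(** * The theorem *)

Definition exp2_cmd : cmd :=
  Read 0 ;; Assign 1 1 ;;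
  While (Reg 0) (Assign 1 (Plus (Reg 1) (Reg 1)) ;; Assign 0 (Minus (Reg 0) 1)) ;;
  Print (Reg 1).

Lemma computable_exp2 : computable (expn 2).
Proof.
exists (compile exp2_cmd) => [|n]; first by vm_compute.
suff [r e [s er <-]] : wp exp2_cmd (start [:: n] [::])
    (fun r => exists2 s, r = Ok s & out s = [:: 2 ^ n]).
  by rewrite er in e; apply: accepts_compile e.
rewrite /exp2_cmd /start; wp_calc.
suff h m v tk : v * 2 ^ m = 2 ^ n -> wp
    (While (Reg 0) (Assign 1 (Plus (Reg 1) (Reg 1)) ;; Assign 0 (Minus (Reg 0) 1)))
    (State [:: m; v; 0; 0; 0; 0; 0; 0; 0; 0; 0; 0; 0; 0; 0; 0]
       (nseq 5 (fun=> 0)) [::] [::] [::] tk)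
    (fun r => exists tk', r = Ok
      (State [:: 0; 2 ^ n; 0; 0; 0; 0; 0; 0; 0; 0; 0; 0; 0; 0; 0; 0]
         (nseq 5 (fun=> 0)) [::] [::] [::] tk')).
  apply: wp_mono; first by apply: h; rewrite mul1n.
  by move=> _ [tk' ->]; rewrite /=; wp_calc; eexists.
elim: m v tk => [|m IH] v tk e.
  by apply: wp_while0 => //; exists tk.+1; rewrite -e muln1.
apply: wp_while1 => //; wp_calc; apply: IH.
by rewrite -e expnS mulnA muln2 addnn.
Qed.

Lemma horner_succ_sq (n : nat) : ((('X + 1) ^+ 2 : {poly nat}).[n])%R = n.+1 ^ 2.
Proof.
by rewrite GRing.expr2 hornerM hornerD hornerX -polyC1 hornerC !natrE addn1 expnS expn1.
Qed.

Definition sat_program : program := compile sat_cmd.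

Lemma sat_program_within w : runs_within sat_program (codes w)
  (2 ^ pinc_arity w * (unit_cost sat_cmd * 400 * (size w).+1 ^ 2)).
Proof.
apply: compile_within => g; have [r e [le _]] := sat_cmd_spec w g.
exists r => //; move: (unit_cost _) (time r) le => c t.
move: 400 ((size w).+1 ^ 2) (2 ^ _) => x y z le.
by rewrite -mulnA mulnCA (mulnCA z) (mulnC z) leq_mul2l le orbT.
Qed.

Lemma sat_program_accepts w o : accepts sat_program (codes w) o <->
  exists phi g, [/\ w = enc phi, good phi g &
    o = codes (enc_team (map (lits phi) (entries phi (limit phi) g)))].
Proof.
split=> [|[phi [g [ew hg ->]]]].
  case/(compile_accepts (sat_cmd_spec w))=> g [s [[_ [phi [ew hg es]]] <-]].
  by exists phi, g.
have [[s|t] e [_ /= hr]] := sat_cmd_spec w g; last by case: (hr _ ew).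
case: hr => psi []; rewrite {1}ew => /enc_inj <- _ <-.
exact: accepts_compile e.
Qed.

Lemma sat_program_satisfiable phi :
  (exists o, accepts sat_program (codes (enc phi)) o) <-> satisfiable phi.
Proof.
split=> [[o /sat_program_accepts [psi [g [/enc_inj <- hg _]]]]|].
  by have [T [_ hT]] := good_witness hg; exists T.
case/satisfiable_good=> g hg.
by eexists; apply/sat_program_accepts; exists phi, g.
Qed.

Theorem theorem4 :
  (exists P : program,
    [/\ exists (C : nat) (p : {poly nat}),
          forall (k : nat) (phi : formula), (arity phi <= k)%N ->
            runs_within P (codes (enc phi))
              (C * (2 ^ k * (p.[size (enc phi)])%R))%N,
        forall phi : formula,
          (exists o : seq nat, accepts P (codes (enc phi)) o)
          <-> satisfiable phi &
        forall (phi : formula) (o : seq nat),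
          accepts P (codes (enc phi)) o ->
          exists (w : word) (T : {fset assignment}),
            [/\ o = codes w, encodes_team w T & witness phi T]]) /\
  paraNP pinc_sat pinc_arity.
Proof.
split.
  exists sat_program; split=> [|phi|phi o].
  (* The number of ticks is at most 400 times the square and the power of two; [unit_cost sat_cmd]
     bounds the machine steps per tick. *)
  - exists (unit_cost sat_cmd * 400), (('X + 1) ^+ 2)%R => k phi hk n c.
    move/(sat_program_within (w := enc phi)) => h; apply: leq_trans h _.
    rewrite horner_succ_sq pinc_arity_enc.
    move: (unit_cost _ * 400) (_ ^ 2) => C x.
    by rewrite mulnCA leq_mul2l leq_mul2r leq_exp2l // hk !orbT.
  - exact: sat_program_satisfiable.
  - case/sat_program_accepts=> psi [g [/enc_inj <- hg ->]].
    have [T [hT wT]] := good_witness hg.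
    by eexists; exists T.
exists sat_program, (expn 2), ((unit_cost sat_cmd * 400)%:P * ('X + 1) ^+ 2)%R.
split=> [|w|w].
- exact: computable_exp2.
- rewrite hornerM hornerC horner_succ_sq.
  exact: sat_program_within.
- split=> [[o /sat_program_accepts [phi [g [ew hg _]]]]|[phi <- hphi]].
    by exists phi => //; apply/sat_program_satisfiable; eexists;
      apply/sat_program_accepts; exists phi, g.
  exact/sat_program_satisfiable.
Qed.
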